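(* There exist a sequence of positive integers $(d_i)_{i\ge1}$ with $d_i\to\infty$ and a constant $C>0$ such that for every $i$, $$c_{d_i}> C\, d_i\,(\log\log d_i)^{7/24},$$ and moreover, for each $i$, this bound is achieved by a lattice symmetric under the linear action of a non-commutative finite group: there exist a lattice $\Lambda_i\subset\mathbb{R}^{d_i}$ of covolume $1$, a non-commutative finite group $H_i$ of invertible linear maps of $\mathbb{R}^{d_i}$ with $h(\Lambda_i)=\Lambda_i$ for all $h\in H_i$, and an origin-centered open ellipsoid $E_i\subset\mathbb{R}^{d_i}$ with $\mathrm{vol}(E_i)> C\,d_i(\log\log d_i)^{7/24}$ and $E_i\cap\Lambda_i=\{0\}$.
   Context: For $d\ge1$, $c_d=\sup\{\mu(gB_r(0)) : r>0,\ g\in SL_d(\mathbb{R}),\ gB_r(0)\cap\mathbb{Z}^d=\{0\}\}$, where $\mu$ is Lebesgue measure on $\mathbb{R}^d$ and $B_r(0)$ is the open Euclidean ball of radius $r$; the best lattice packing density in dimension $d$ equals $2^{-d}c_d$. *)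

(* Defs.v *)
From HB Require Import structures.
From mathcomp Require Import all_boot all_order all_algebra.
From mathcomp Require Import all_classical all_reals all_analysis.

Set Implicit Arguments.
Unset Strict Implicit.
Unset Printing Implicit Defensive.

Import Order.TTheory GRing.Theory Num.Theory.
Import numFieldNormedType.Exports.

Local Open Scope classical_set_scope.
Local Open Scope ring_scope.

(* R^d is 'cV[R]_d.  The library norm on matrices is the sup norm, hence the
   separate Euclidean norm. *)
Definition enorm (R : realType) (d : nat) (x : 'cV[R]_d) : R :=
  Num.sqrt (\sum_(i < d) x i 0 ^+ 2).

Definition eball (R : realType) (d : nat) (r : R) : set 'cV[R]_d :=
  [set x : 'cV[R]_d | enorm x < r].

Arguments eball {R d} r.

Definition int_vectors (R : realType) (d : nat) : set 'cV[R]_d :=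
  [set x : 'cV[R]_d | forall i, x i 0 \is a Num.int].

Arguments int_vectors {R d}.

Definition linear_image (R : realType) (d : nat) (g : 'M[R]_d)
    (A : set 'cV[R]_d) : set 'cV[R]_d :=
  [set g *m x | x in A].

Definition box (R : realType) (d : nat) (a b : 'cV[R]_d) : set 'cV[R]_d :=
  [set x : 'cV[R]_d | forall i, a i 0 < x i 0 <= b i 0].

(* Lebesgue outer measure on R^d for d > 0, through countable covers by boxes;
   it is the Lebesgue measure on measurable sets. *)
Definition lebesgue_vol (R : realType) (d : nat) (A : set 'cV[R]_d) : \bar R :=
  ereal_inf [set v : \bar R | exists a b : nat -> 'cV[R]_d,
    [/\ forall k i, a k i 0 <= b k i 0,
        A `<=` \bigcup_k box (a k) (b k)
      & v = (\sum_(0 <= k <oo)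
               (\prod_(i < d) (b k i 0 - a k i 0))%:E)%E]].

(* The supremum is taken in the extended reals, where it always exists. *)
Definition lattice_packing_constant (R : realType) (d : nat) : \bar R :=
  ereal_sup [set v : \bar R | exists (r : R) (g : 'M[R]_d),
    [/\ 0 < r, \det g = 1,
        linear_image g (eball r) `&` int_vectors = [set 0]
      & v = lebesgue_vol (linear_image g (eball r))]].

(* L is the Z-span of the columns of an invertible matrix B, and its covolume
   |det B| is v. *)
Definition lattice_of_covolume (R : realType) (d : nat) (v : R)
    (L : set 'cV[R]_d) : Prop :=
  exists B : 'M[R]_d,
    [/\ B \in unitmx, L = linear_image B int_vectors
      & `|\det B| = v].

Definition is_matrix_group (R : realType) (d : nat) (H : set 'M[R]_d) : Prop :=
  [/\ forall h, H h -> h \in unitmx,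
      H 1%:M,
      forall h1 h2, H h1 -> H h2 -> H (h1 *m h2)
    & forall h, H h -> H (invmx h)].

Definition noncommutative (R : realType) (d : nat) (H : set 'M[R]_d) : Prop :=
  exists h1 h2, [/\ H h1, H h2 & h1 *m h2 != h2 *m h1].

Definition is_open_ellipsoid (R : realType) (d : nat) (E : set 'cV[R]_d) :
    Prop :=
  exists2 g : 'M[R]_d, g \in unitmx & E = linear_image g (eball 1).

(* Main.v *)
(* Let m = y! and O = Z[zeta_m].  The dicyclic group generated by zeta (of order
   m) and j, with j^2 = -1 and j a = conj(a) j, acts without fixed points on
   the totally definite quaternion order O + O j.  On (O + O j)^3, of rank
   d = 6 phi(m), take the left submodules Lambda_l cut out by a functional l
   over F_p, where Phi_m has a root modulo the large prime p: they have index at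
   most p^2.  A vector whose image is degenerate modulo p has a component of
   reduced norm divisible by p, hence is too long to matter, and any other
   nonzero vector lies in Lambda_l for one l out of p^2.  As nonzero vectors come
   in orbits of size m, averaging over l yields a Lambda_l without nonzero point
   in a zeta-invariant ellipsoid of normalised volume at least m / 32.  Finally
   m / phi(m) >= sum_(k <= y) 1/k >= log y, which is of order log log d.

   Volumes are handled through lattice point counts only: the outer measure of
   an ellipsoid is at least the upper limit of the rescaled number of integer
   points in its dilations. *)

Require Import Defs.
From HB Require Import structures.
From mathcomp Require Import all_boot all_order all_algebra all_field.
From mathcomp Require Import perm cyclic mxabelem zify ring lra.
From mathcomp Require Import all_classical all_reals all_analysis.

Set Implicit Arguments.
Unset Strict Implicit.
Unset Printing Implicit Defensive.

Import Order.TTheory GRing.Theory Num.Theory.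
Import numFieldNormedType.Exports.

Local Open Scope ring_scope.

Notation intmx := (map_mx intr).

(** * The quotient m / phi(m) for factorials *)

(** Coprimality to [d * e] forces coprimality to [e], and the integers below [d * e] form [d]
    periods of length [e], each containing [totient e] integers coprime to [e]. *)
Lemma totient_mul_le (d e : nat) : (totient (d * e) <= d * totient e)%N.
Proof.
have shift k : (\sum_(k * e <= i < k.+1 * e) coprime e i = totient e)%N.
  rewrite -{1}[(k * e)%N]add0n big_addn mulSn addnK totient_count_coprime.
  apply: eq_bigr => i _.
  by rewrite -coprime_modr addnC modnMDl coprime_modr.
have -> : (d * totient e = \sum_(0 <= i < d * e) coprime e i)%N.
  elim: d => [|d IHd]; first by rewrite !mul0n big_geq.
  rewrite (big_cat_nat (n := (d * e)%N)) //=; last by rewrite leq_mul2r leqnSn orbT.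
  by rewrite shift -IHd mulSn addnC.
rewrite totient_count_coprime; apply: leq_sum => i _.
by rewrite coprimeMl; case: (coprime d i); case: (coprime e i).
Qed.

(** Gauss's identity writes [m] as the sum of phi(m / d) over the divisors [d] of [m], and phi(m /
    d) is at least phi(m) / d by [totient_mul_le]. *)
Lemma totient_sum_inv (R : realFieldType) (m : nat) : (0 < m)%N ->
  (totient m)%:R * \sum_(d < m.+1 | (d %| m)%N) (d%:R^-1 : R) <= m%:R.
Proof.
move=> m_gt0; rewrite -[in leRHS](sum_totient_dvd m) natr_sum.
have divK d : (d %| m)%N -> (m %/ (m %/ d) = d)%N.
  by move=> dm; rewrite divnA // mulKn.
have le_m d : (m %/ d < m.+1)%N by rewrite ltnS leq_div.
rewrite [leRHS](reindex_onto (fun d : 'I_m.+1 => inord (m %/ d)) (fun d => inord (m %/ d))) /=.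
  rewrite mulr_sumr big_mkcond [leRHS]big_mkcond; apply: ler_sum => d _.
  rewrite !inordK //; case: ifP => [dm|_]; last by case: ifP.
  rewrite dvdn_div //= divK // inord_val eqxx.
  have d_gt0 : (0 < d)%N by apply: dvdn_gt0 dm.
  rewrite ler_pdivrMr ?ltr0n // mulrC -natrM ler_nat -{1}(divnK dm) mulnC.
  exact: totient_mul_le.
by move=> d dm; apply: val_inj; rewrite /= !inordK // divK.
Qed.

Lemma ln_le_harmonic (R : realType) (y : nat) :
  ln (y.+1%:R : R) <= \sum_(k < y) k.+1%:R^-1.
Proof.
elim: y => [|y IHy]; first by rewrite ln1 big_ord0.
have y_gt0 : 0 < y.+1%:R :> R by rewrite ltr0n.
have -> : y.+2%:R = y.+1%:R * (1 + y.+1%:R^-1) :> R.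
  by rewrite mulrDr mulr1 divff ?gt_eqF // -natr1.
rewrite big_ord_recr /= lnM ?posrE ?addr_gt0 ?invr_gt0 // lerD //.
by apply: le_ln1Dx; rewrite (lt_trans (ltrN10 _)) // invr_gt0.
Qed.

(** Each of 1, ..., y divides y!, so the sum of inverse divisors dominates the harmonic sum, hence
    the logarithm. *)
Lemma totient_fact (R : realType) (y : nat) :
  (totient y`!)%:R * ln (y.+1%:R : R) <= (y`!)%:R.
Proof.
apply: le_trans (totient_sum_inv R (fact_gt0 y)).
rewrite ler_wpM2l // (le_trans (ln_le_harmonic _ _)) //.
have lt_fact (k : 'I_y) : (k.+1 < y`!.+1)%N.
  by rewrite ltnS dvdn_leq ?fact_gt0 // dvdn_fact //= ltn_ord.
pose f (k : 'I_y) : 'I_y`!.+1 := Ordinal (lt_fact k).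
have f_inj : {in predT &, injective f} by move=> i j _ _ [/val_inj].
have imf d : d \in [set f k | k in predT] -> (d %| y`!)%N.
  by case/imsetP=> k _ ->; rewrite dvdn_fact //= ltn_ord.
rewrite (eq_bigr (fun k => (f k)%:R^-1)) //.
rewrite -(big_imset (fun d : 'I_y`!.+1 => (d%:R^-1 : R)) f_inj) /=.
rewrite big_mkcond [leRHS]big_mkcond; apply: ler_sum => d _.
case: ifP => [/imf -> //|_]; by case: ifP => // _; rewrite invr_ge0.
Qed.

(** Put L = ln (y + 1). From d <= (y + 1)^(y + 2) and L <= y comes ln d <= (y + 1)^2, so ln (ln d)
    <= 2 L. As 2 L >= 1, its power 7/24 is at most 2 L too, and [totient_fact] concludes. *)
Lemma loglog_growth (R : realType) (y : nat) (d := (6 * totient y`!)%N) :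
  (2 <= y)%N ->
  400^-1 * d%:R * ln (ln (d%:R : R)) `^ (7 / 24) < (y`!)%:R / 32.
Proof.
move=> y2; set t := ln (ln _).
have L_ge : 1 <= 2 * ln (y.+1%:R : R).
  have /le_ln1Dx : -1 < (y.+1%:R^-1 - 1 : R).
    by rewrite ltrBrDr addNr invr_gt0 ltr0n.
  rewrite addrCA subrr addr0 lnV ?posrE ?ltr0n //.
  have : y.+1%:R^-1 <= 2^-1 :> R by rewrite lef_pV2 ?posrE ?ltr0n // ler_nat; lia.
  move: (_^-1) (ln _) => u v; lra.
have d_gt0 : (0 < d)%N by rewrite muln_gt0 totient_gt0 fact_gt0.
have t_le : t <= 2 * ln (y.+1%:R : R).
  have lnd_le : ln (d%:R : R) <= y.+1%:R ^+ 2.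
    have d_le : (d <= y.+1 ^ y.+2)%N.
      have f_le k : (k`! <= k.+1 ^ k)%N.
        elim: k => // k IHk; rewrite factS expnS leq_mul //.
        by apply: leq_trans IHk _; case: k => // k; rewrite leq_exp2r // leqnSn.
      have -> : (y.+1 ^ y.+2 = y.+1 ^ 2 * y.+1 ^ y)%N by rewrite -expnD.
      apply: leq_mul; first by rewrite expnS expn1; nia.
      apply: leq_trans (f_le y); rewrite totient_count_coprime.
      rewrite -[leqRHS]subn0 -[leqRHS]mul1n mulnC.
      by rewrite -sum_nat_const_nat; apply: leq_sum => i _; case: coprime.
    have : ln (d%:R : R) <= ln (y.+1%:R ^+ y.+2).
      by rewrite ler_ln ?posrE ?exprn_gt0 ?ltr0n // -natrX ler_nat.
    move/le_trans; apply; rewrite lnXn ?ltr0n //.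
    have : ln (y.+1%:R : R) <= y%:R.
      by rewrite -addn1 natrD addrC le_ln1Dx // (lt_le_trans (ltrN10 _)).
    rewrite -[ln _ *+ _]mulr_natr => /(ler_wpM2r (ler0n R y.+2))/le_trans; apply.
    rewrite -natrM -natrX ler_nat; lia.
  rewrite /t; have [l0|l0] := leP (ln (d%:R : R)) 0; first by rewrite ln0 //; lra.
  have -> : 2 * ln y.+1%:R = ln (y.+1%:R^+2 : R) by rewrite lnXn ?ltr0n // mulr_natl.
  by rewrite ler_ln ?posrE ?exprn_gt0 ?ltr0n.
have pow_le : t `^ (7 / 24) <= 2 * ln (y.+1%:R : R).
  have [t0|t0] := leP 0 t.
    apply: le_trans (_ : (2 * ln (y.+1%:R : R)) `^ (7 / 24) <= _).
      by rewrite ge0_ler_powR ?nnegrE //; lra.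
    by rewrite ler1_powR //; lra.
  (* For a negative base [ln] takes its default value 0, so the power equals 1. *)
  by rewrite /powR lt_eqF // (ln0 (ltW t0)) mulr0 expR0.
have phi_le := totient_fact R y.
have m_gt0 : 0 < (y`!)%:R :> R by rewrite ltr0n fact_gt0.
apply: (@le_lt_trans _ _ (400^-1 * d%:R * (2 * ln (y.+1%:R : R)))).
  by rewrite ler_wpM2l // mulr_ge0 // invr_ge0.
rewrite /d natrM; set P := (totient _)%:R in phi_le *; set L := ln _ in phi_le *.
(* The choice of 400 is settled here: 6 * 2 / 400 lies just below 1 / 32 = 12.5 / 400. *)
rewrite (_ : _ * _ = 12 / 400 * (P * L)); last by field.
lra.
Qed.

(** * Cyclotomic integers as integer matrices *)

(** A row of coefficients times this column is the value at [x] of the polynomial with these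
    coefficients. *)
Definition powers (S : pzRingType) (n : nat) (x : S) : 'cV[S]_n :=
  \col_(i < n) x ^+ i.

Definition cyc_red (m : nat) (q : {poly int}) : 'rV[int]_(totient m) :=
  poly_rV (Pdiv.Ring.rmodp q 'Phi_m).

(** Elements of Z[zeta] are coefficient rows, and matrices act on the right: [zeta_mx] is
    multiplication by zeta, and [conj_mx] substitutes zeta^(m-1), the complex conjugate of zeta. *)
Definition zeta_mx (m : nat) : 'M[int]_(totient m) :=
  \matrix_(i < totient m) cyc_red m 'X^(i.+1).

Definition conj_mx (m : nat) : 'M[int]_(totient m) :=
  \matrix_(i < totient m) cyc_red m 'X^(i * m.-1).

(** The ring is left arbitrary so that the same evaluation identities serve at a primitive root in
    [algC] and at a root in ['F_p]. *)
Definition cyc_root (S : comNzRingType) (m : nat) (x : S) : bool :=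
  root (map_poly intr ('Phi_m : {poly int})) x.

Lemma poly_rV_powers (S : comNzRingType) (n : nat) (q : {poly int}) (x : S) :
  (size q <= n)%N ->
  (intmx (poly_rV q : 'rV[int]_n) *m powers n x) 0 0 = (map_poly intr q).[x].
Proof.
move=> le_q; rewrite mxE (@horner_coef_wide _ n); last first.
  by apply: leq_trans le_q; apply: size_poly.
by apply: eq_bigr => i _; rewrite !mxE coef_map.
Qed.

Lemma cyc_red_powers (S : comNzRingType) (m : nat) (q : {poly int}) (x : S) :
  cyc_root m x ->
  (intmx (cyc_red m q) *m powers (totient m) x) 0 0 = (map_poly intr q).[x].
Proof.
move=> /rootP rx; have Phi_mon := Cyclotomic_monic m.
rewrite /cyc_red poly_rV_powers; last first.
  rewrite -ltnS -size_Cyclotomic Pdiv.Ring.ltn_rmodpN0 //.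
  exact: monic_neq0.
rewrite [in RHS](Pdiv.RingMonic.rdivp_eq Phi_mon q) rmorphD rmorphM /=.
by rewrite hornerD hornerM rx mulr0 add0r.
Qed.

Lemma zeta_mx_powers (S : comNzRingType) (m : nat) (x : S) : cyc_root m x ->
  intmx (zeta_mx m) *m powers (totient m) x = x *: powers (totient m) x.
Proof.
move=> rx; apply/colP => i; have := cyc_red_powers 'X^(i.+1) rx.
rewrite map_polyXn hornerXn !mxE -exprS => <-.
by apply: eq_bigr => j _; rewrite !mxE.
Qed.

Lemma conj_mx_powers (S : comNzRingType) (m : nat) (x : S) : cyc_root m x ->
  intmx (conj_mx m) *m powers (totient m) x = powers (totient m) (x ^+ m.-1).
Proof.
move=> rx; apply/colP => i; have := cyc_red_powers 'X^(i * m.-1) rx.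
rewrite map_polyXn hornerXn !mxE -exprM [(m.-1 * i)%N]mulnC => <-.
by apply: eq_bigr => j _; rewrite !mxE.
Qed.

Lemma cyc_root_prim (m : nat) (z : algC) :
  m.-primitive_root z -> cyc_root m z.
Proof.
by move=> pz; rewrite /cyc_root (Cintr_Cyclotomic pz) root_cyclotomic.
Qed.

Lemma cyc_root_X (S : comNzRingType) (m : nat) (x : S) : (0 < m)%N ->
  cyc_root m x -> x ^+ m = 1.
Proof.
move=> m_gt0 /rootP rx; apply/eqP; rewrite -subr_eq0.
have := congr1 (fun q : {poly int} => (map_poly intr q).[x]) (prod_Cyclotomic m_gt0).
rewrite (big_rem m) -?dvdn_divisors //= rmorphM hornerM rx mul0r.
by rewrite rmorphB /= rmorph1 map_polyXn hornerD hornerN hornerXn hornerC => <-.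
Qed.

(** The minimal polynomial of a primitive [m]-th root over the rationals has degree phi(m), more
    than the degree of a polynomial with phi(m) coefficients. *)
Lemma powers_free (m : nat) (z : algC) (v : 'rV[int]_(totient m)) :
  m.-primitive_root z -> intmx v *m powers (totient m) z = 0 -> v = 0.
Proof.
move=> pz /matrixP/(_ 0 0); rewrite [RHS]mxE -[v]rVpolyK.
rewrite poly_rV_powers; last by rewrite size_poly.
set q := rVpoly v => q0.
suff -> : q = 0 by rewrite linear0.
have [pf [Dpf mon_pf] dv_pf] := minCpolyP z.
have /esym := dv_pf (map_poly intr q).
rewrite -map_poly_comp (eq_map_poly (g := intr)); last by move=> b /=; rewrite rmorph_int.
rewrite /root q0 eqxx => /(dvdp_leq _) le_sz.
apply/eqP; apply/negPn/negP => q_neq0.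
have qQ_neq0 : map_poly (intr : int -> rat) q != 0.
  by rewrite map_poly_eq0_id0 // intr_eq0 lead_coef_eq0.
move: (le_sz qQ_neq0).
rewrite -(size_map_poly (ratr : {rmorphism rat -> algC})) -Dpf (minCpoly_cyclotomic pz) size_cyclotomic.
rewrite leqNgt ltnS (leq_trans (size_poly _ _)) //.
exact: size_poly.
Qed.

(** This reduces the relations between [zeta_mx] and [conj_mx] to identities between complex
    numbers. *)
Lemma mx_powers_inj (m r : nat) (z : algC) (A B : 'M[int]_(r, totient m)) :
  m.-primitive_root z ->
  intmx A *m powers (totient m) z = intmx B *m powers (totient m) z -> A = B.
Proof.
move=> pz eqAB; apply/eqP; rewrite -subr_eq0; apply/eqP/row_matrixP => i.
rewrite row0; apply: (powers_free pz).
by rewrite map_row map_mxB -row_mul mulmxBl eqAB subrr row0.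
Qed.

Lemma prim_root_inv (S : fieldType) (m : nat) (z : S) :
  m.-primitive_root z -> z ^+ m.-1 = z^-1.
Proof.
move=> pz; have m_gt0 := prim_order_gt0 pz.
have z_neq0 : z != 0.
  apply: contra_eq_neq (prim_expr_order pz) => ->.
  by rewrite expr0n gtn_eqF // eq_sym oner_neq0.
by apply: (mulfI z_neq0); rewrite divff // -exprS prednK // prim_expr_order.
Qed.

Section Relations.
Variables (m : nat) (m_gt0 : (0 < m)%N).
Let n := totient m.
Let Z := zeta_mx m.
Let J := conj_mx m.

Lemma zeta_mxX_powers (S : comNzRingType) (x : S) k : cyc_root m x ->
  intmx (Z ^+ k) *m powers n x = x ^+ k *: powers n x.
Proof.
move=> rx; elim: k => [|k IHk].
  by rewrite expr0 (map_mx1 intr) mul1mx expr0 scale1r.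
rewrite exprS -mulmxE (map_mxM intr) -mulmxA IHk -scalemxAr zeta_mx_powers //.
by rewrite scalerA -exprSr.
Qed.

Lemma zeta_mx_order : Z ^+ m = 1%:M.
Proof.
have [z pz] := C_prim_root_exists m_gt0.
apply: (mx_powers_inj pz); rewrite zeta_mxX_powers ?cyc_root_prim //.
by rewrite (prim_expr_order pz) scale1r (map_mx1 intr) mul1mx.
Qed.

Let inv_prim (z : algC) : m.-primitive_root z -> m.-primitive_root (z ^+ m.-1).
Proof.
by move=> pz; rewrite prim_root_exp_coprime //; case: m m_gt0 => // k _; apply: coprimenS.
Qed.

Lemma conj_mx_invol : J *m J = 1%:M.
Proof.
have [z pz] := C_prim_root_exists m_gt0.
apply: (mx_powers_inj pz).
rewrite (map_mxM intr) -mulmxA !conj_mx_powers ?cyc_root_prim //; last exact: inv_prim.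
by rewrite (map_mx1 intr) mul1mx (prim_root_inv pz) exprVn (prim_root_inv pz) invrK.
Qed.

Lemma zeta_conj_mx : Z *m J = J *m (Z ^+ m.-1).
Proof.
have [z pz] := C_prim_root_exists m_gt0.
apply: (mx_powers_inj pz).
rewrite !(map_mxM intr) -!mulmxA zeta_mxX_powers ?cyc_root_prim //.
rewrite -scalemxAr !conj_mx_powers ?cyc_root_prim //.
by rewrite zeta_mx_powers // cyc_root_prim // inv_prim.
Qed.

Lemma zeta_mx_fpf (v : 'rV[int]_n) i k : (i < k < m)%N ->
  v *m Z ^+ i = v *m Z ^+ k -> v = 0.
Proof.
move=> /andP[lt_ik lt_km] eqv; have [z pz] := C_prim_root_exists m_gt0.
apply: (powers_free pz).
have := congr1 (fun A => map_mx intr A *m powers n z) eqv.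
rewrite /= !(map_mxM intr) -!mulmxA !zeta_mxX_powers ?cyc_root_prim //.
rewrite -!scalemxAr => /eqP; rewrite -subr_eq0 -scalerBl scalemx_eq0.
case/orP => [|/eqP //]; rewrite subr_eq0 (eq_prim_root_expr pz).
by rewrite !modn_small ?(ltn_trans lt_ik) // ltn_eqF.
Qed.

End Relations.

(** * The reduced norm of a quaternion *)

Section Norm.
Variables (m : nat) (m_gt0 : (0 < m)%N).
Let n := totient m.
Let Z := zeta_mx m.
Let J := conj_mx m.

Definition mul_cyc (a : 'rV[int]_(totient m)) : 'M[int]_(totient m) :=
  \sum_i a 0 i *: zeta_mx m ^+ i.

Lemma mul_cyc_powers (S : comNzRingType) (x : S) a : cyc_root m x ->
  intmx (mul_cyc a) *m powers n x = (intmx a *m powers n x) 0 0 *: powers n x.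
Proof.
move=> rx; rewrite /mul_cyc (map_mx_sum intr).
rewrite mulmx_suml mxE scaler_suml; apply: eq_bigr => i _.
by rewrite (map_mxZ intr) -scalemxAl (zeta_mxX_powers _ rx) scalerA !mxE.
Qed.

(* The matrix of multiplication by [a conj(a) + b conj(b)], the reduced norm of
   the quaternion [a + b j]. *)
Definition nrd_mx (a b : 'rV[int]_(totient m)) : 'M[int]_(totient m) :=
  mul_cyc a *m mul_cyc (a *m J) + mul_cyc b *m mul_cyc (b *m J).

(** The reduced norm seen through the evaluation at [x]; it is the eigenvalue of [nrd_mx] on
    [powers n x]. *)
Definition nrd_val (S : comNzRingType) (x : S) (a b : 'rV[int]_(totient m)) : S :=
  let ev v := (intmx v *m powers n x) 0 0 in
  ev a * ev (a *m J) + ev b * ev (b *m J).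

Lemma nrd_mx_powers (S : comNzRingType) (x : S) a b : cyc_root m x ->
  intmx (nrd_mx a b) *m powers n x = nrd_val x a b *: powers n x.
Proof.
move=> rx; rewrite map_mxD !(map_mxM intr) mulmxDl -!mulmxA !(mul_cyc_powers _ rx).
rewrite -!scalemxAr !(mul_cyc_powers _ rx) !scalerA -scalerDl.
by rewrite /nrd_val mulrC [X in _ + X]mulrC.
Qed.

(** At a primitive complex root [z], [conj_mx] evaluates to complex conjugation, so the eigenvalue
    is |a(z)|^2 + |b(z)|^2. A vector in the kernel would force it to vanish, hence [a] and [b] to be
    zero. *)
Lemma nrd_mx_unit a b : (a, b) != (0, 0) -> \det (nrd_mx a b) != 0.
Proof.
move=> ab_neq0; have [z pz] := C_prim_root_exists m_gt0.
have rz := cyc_root_prim pz.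
apply/negP => /det0P [v v_neq0 vN].
have := congr1 (fun A => intmx A *m powers n z) vN.
rewrite /= (map_mxM intr) -mulmxA nrd_mx_powers // -scalemxAr map_mx0 mul0mx.
move=> /eqP; rewrite scalemx_eq0 => /orP[|/eqP /(powers_free pz) v0]; last first.
  by rewrite v0 eqxx in v_neq0.
have normz1 : `|z| = 1.
  by apply/eqP; rewrite -(pexpr_eq1 m_gt0) // -normrX (prim_expr_order pz) normr1.
have conjE (c : 'rV[int]_n) : (intmx (c *m J) *m powers n z) 0 0 =
    ((intmx c *m powers n z) 0 0)^*.
  rewrite (map_mxM intr) -mulmxA conj_mx_powers // !mxE rmorph_sum /=.
  apply: eq_bigr => i _; rewrite !mxE rmorphM rmorphXn /= rmorph_int.
  by rewrite (prim_root_inv pz) invC_norm normz1 expr1n invr1 mul1r.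
rewrite /nrd_val !conjE -!normCK paddr_eq0 ?exprn_ge0 // !expf_eq0 /= !normr_eq0.
have ev0 (c : 'rV[int]_n) : (intmx c *m powers n z) 0 0 == 0 -> c = 0.
  move=> /eqP c0; apply: (powers_free pz); apply/matrixP => i j.
  by rewrite !ord1 c0 mxE.
by case/andP => /ev0 a0 /ev0 b0; rewrite a0 b0 eqxx in ab_neq0.
Qed.


End Norm.

(** * Size of the reduced norm and its reduction modulo primes *)

Definition mx_bound (r c : nat) (K : int) (A : 'M[int]_(r, c)) : Prop :=
  forall i j, `|A i j| <= K.

Lemma mx_boundD (r c : nat) (K L : int) (A B : 'M[int]_(r, c)) :
  mx_bound K A -> mx_bound L B -> mx_bound (K + L) (A + B).
Proof.
by move=> bA bB i j; rewrite mxE (le_trans (ler_normD _ _)) // lerD.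
Qed.

Lemma mx_boundM (r k c : nat) (K L : int) (A : 'M[int]_(r, k)) (B : 'M[int]_(k, c)) :
  mx_bound K A -> mx_bound L B -> mx_bound (k%:Z * (K * L)) (A *m B).
Proof.
move=> bA bB i j; rewrite mxE (le_trans (ler_norm_sum _ _ _)) //.
have -> : k%:Z * (K * L) = \sum_(l < k) (K * L).
  by rewrite sumr_const card_ord -mulr_natl natz.
by apply: ler_sum => l _; rewrite normrM ler_pM.
Qed.

Lemma mx_bound_exists (r c : nat) (A : 'M[int]_(r, c)) :
  exists K : nat, mx_bound K%:Z A.
Proof.
exists (\sum_i \sum_j `|A i j|)%N => i j.
by rewrite -abszE lez_nat (bigD1 i) //= (bigD1 j) //= -addnA leq_addr.
Qed.

Lemma det_bound (r : nat) (K : int) (A : 'M[int]_r) :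
  mx_bound K A -> `|\det A| <= (r`!)%:Z * K ^+ r.
Proof.
move=> bA; rewrite /determinant (le_trans (ler_norm_sum _ _ _)) //.
have -> : (r`!)%:Z * K ^+ r = \sum_(s : 'S_r) K ^+ r.
  by rewrite sumr_const card_Sn -mulr_natl natz.
apply: ler_sum => s _; rewrite normrM normrX normrN normr1 expr1n mul1r normr_prod.
rewrite -[X in K ^+ X]card_ord -prodr_const.
by apply: ler_prod => i _; rewrite normr_ge0 bA.
Qed.

Lemma mul_cyc_bound (m : nat) :
  exists K : nat, forall (T : int) (a : 'rV[int]_(totient m)),
    mx_bound T a -> mx_bound (K%:Z * T) (mul_cyc a).
Proof.
have /choice [K bK] := fun i : 'I_(totient m) => mx_bound_exists (zeta_mx m ^+ i).
exists (\sum_i K i)%N => T a ba i j.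
rewrite /mul_cyc summxE (le_trans (ler_norm_sum _ _ _)) //.
rewrite -natz natr_sum mulr_suml; apply: ler_sum => l _.
by rewrite mxE normrM mulrC natz ler_pM //; apply: bK.
Qed.

(** The entries of [nrd_mx a b] are quadratic in those of [a] and [b], and the determinant has
    degree phi(m) in them; [C] depends on [m] only. *)
Lemma nrd_mx_bound (m : nat) :
  exists C : nat, forall (T : nat) (a b : 'rV[int]_(totient m)),
    mx_bound T%:Z a -> mx_bound T%:Z b ->
    (`|\det (nrd_mx a b)| <= C * T ^ (2 * totient m))%N.
Proof.
set n := totient m; have [K bK] := mul_cyc_bound m.
have [L bL] := mx_bound_exists (conj_mx m).
exists (n`! * (2 * (n * (K * (K * (n * L))))) ^ n)%N => T a b ba bb.
have bJ c : mx_bound T%:Z c -> mx_bound (n%:Z * (T%:Z * L%:Z)) (c *m conj_mx m).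
  by move=> bc; apply: mx_boundM.
have bmul c : mx_bound T%:Z c ->
    mx_bound (n%:Z * (K%:Z * T%:Z * (K%:Z * (n%:Z * (T%:Z * L%:Z)))))
      (mul_cyc c *m mul_cyc (c *m conj_mx m)).
  by move=> bc; apply: mx_boundM; apply: bK => //; apply: bJ.
have := det_bound (mx_boundD (bmul a ba) (bmul b bb)).
rewrite -/(nrd_mx a b) -lez_nat abszE => /le_trans; apply.
rewrite le_eqVlt; apply/orP; left; apply/eqP.
rewrite expnM -mulnA -expnMn PoszM -[Posz (_ ^ n)%N]natz natrX natz.
congr (_ * _ ^+ _); rewrite !PoszM; ring.
Qed.

(** Modulo [p], the column [powers _ w] lies in the kernel of the norm matrix; it is nonzero because
    its first entry is 1. *)
Lemma nrd_singular (m : nat) (p : nat) (w : 'F_p) (a b : 'rV[int]_(totient m)) :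
  (0 < m)%N -> prime p -> cyc_root m w -> nrd_val w a b = 0 ->
  (p %| `|\det (nrd_mx a b)|)%N.
Proof.
move=> m_gt0 p_pr rw val0.
have := nrd_mx_powers a b rw; rewrite val0 scale0r => N0.
have det0 : \det (intmx (nrd_mx a b) : 'M['F_p]__) = 0.
  apply/eqP; rewrite -det_tr; apply/det0P; exists (powers _ w)^T.
    have n_gt0 : (0 < totient m)%N by rewrite totient_gt0.
    apply/eqP => /matrixP /(_ 0 (Ordinal n_gt0)) /eqP.
    by rewrite !mxE expr0 oner_eq0.
  by rewrite -trmx_mul N0 trmx0.
rewrite det_map_mx in det0.
have : (p%:Z %| \det (nrd_mx a b))%Z by rewrite (dvdz_pcharf (pchar_Fp p_pr)) det0.
by rewrite dvdzE.
Qed.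

(** Take a prime factor [p] of Phi_m(a) with [a] a multiple of N!. If [p] were at most [N], it would
    divide [a], whereas a root of Phi_m modulo [p] satisfies a^m = 1. *)
Lemma cyc_prime_exists (m N : nat) : (0 < m)%N ->
  exists p (w : 'F_p), [/\ (N < p)%N, prime p & cyc_root m w].
Proof.
move=> m_gt0; set q := 'Phi_m.
(* A non-root of [P] makes Phi_m(a) different from 0, 1 and -1, so that it has a prime factor;
   [size P] distinct candidates cannot all be roots. *)
pose P := q * (q - 1) * (q + 1).
have sz_q : (1 < size q)%N by rewrite size_Cyclotomic ltnS totient_gt0.
have qc_neq0 (c : int) : q + c%:P != 0.
  apply: contraTneq sz_q => /eqP; rewrite addr_eq0 => /eqP ->.
  by rewrite -polyCN -leqNgt size_polyC_leq1.
have P_neq0 : P != 0.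
  have := qc_neq0 1; have := qc_neq0 (- 1); rewrite polyCN polyC1 => q1 q2.
  by rewrite !mulf_neq0 // monic_neq0 // Cyclotomic_monic.
pose rs := [seq (N`! * k)%:Z | k <- iota 0 (size P)].
have rs_uniq : uniq rs.
  rewrite map_inj_uniq ?iota_uniq // => i j [] /eqP.
  by rewrite eqn_pmul2l ?fact_gt0 // => /eqP.
have /allPn [x /mapP [k _ ->]] : ~~ all (root P) rs.
  apply/negP => all_rs; have := max_poly_roots P_neq0 all_rs rs_uniq.
  by rewrite size_map size_iota ltnn.
set a := (N`! * k)%N%:Z; rewrite !rootM /root !hornerE !negb_or => /andP[/andP[qa0 qa1] qa2].
have qa_gt1 : (1 < `|q.[a]|)%N.
  move: qa0 qa1 qa2; move: (q.[a]) => v.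
  by case: v => [[|[|v]]|[|v]].
pose p := pdiv `|q.[a]|%N; have p_pr : prime p by apply: pdiv_prime.
have rw : cyc_root m (a%:~R : 'F_p).
  rewrite /cyc_root /root horner_map -(dvdz_pcharf (pchar_Fp p_pr)) dvdzE.
  exact: pdiv_dvd.
exists p, a%:~R; split => //; rewrite ltnNge; apply/negP => le_pN.
have := cyc_root_X m_gt0 rw; have -> : a%:~R = 0 :> 'F_p.
  apply/eqP; rewrite -(dvdz_pcharf (pchar_Fp p_pr)) dvdzE /= dvdn_mulr //.
  by rewrite dvdn_fact // prime_gt0.
by rewrite expr0n gtn_eqF // => /eqP; rewrite eq_sym oner_eq0.
Qed.

(** * Quaternionic lattices modulo a prime *)

Lemma int_sum_delta (d : nat) (x : 'cV[int]_d) :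
  x = \sum_i (delta_mx i 0) *~ x i 0.
Proof.
apply/colP => i; rewrite summxE (bigD1 i) //= big1 => [|k ki].
  by rewrite addr0 -scaler_int !mxE eqxx intz mulr1.
by rewrite -scaler_int !mxE eq_sym (negbTE ki) mulr0.
Qed.

(** If [f] is nonzero at the basis vector [i0], then membership in the kernel is one congruence
    modulo [p], which expresses the coordinate [i0] through the others and a multiple of [p]. *)
Lemma kernel_basis (d p : nat) (f : {additive 'cV[int]_d -> 'F_p}) : prime p ->
  exists2 B : 'M[int]_d, \det B != 0 &
    forall x, f x = 0 <-> exists y, x = B *m y.
Proof.
move=> p_pr; have [[i0 ci0]|c0] := pselect (exists i, f (delta_mx i 0) != 0); last first.
  exists 1%:M => [|x]; first by rewrite det1 oner_eq0.
  split=> _; first by exists x; rewrite mul1mx.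
  rewrite [x]int_sum_delta raddf_sum big1 // => i _; rewrite raddfMz.
  have [->|fi] := eqVneq (f (delta_mx i 0)) 0; first by rewrite mul0rz.
  by case: c0; exists i.
set c := f (delta_mx i0 0) in ci0.
pose u (i : 'I_d) : nat := (f (delta_mx i 0) / c : 'F_p).
have uE i : (u i)%:R * c = f (delta_mx i 0) by rewrite natr_Zp divfK.
(* Row [i0] of [B] is to have [p] at [i0] and [- u i] elsewhere; the identity already contributes 1
   on the diagonal, whence [p - 1]. *)
pose v : 'rV[int]_d := \row_i (if i == i0 then p%:Z - 1 else - (u i)%:Z).
pose B : 'M[int]_d := 1%:M + delta_mx i0 0 *m v.
have BE (y : 'cV[int]_d) i : (B *m y) i 0 = y i 0 + (if i == i0 then (v *m y) 0 0 else 0).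
  rewrite mulmxDl mul1mx mxE; congr (_ + _); rewrite -mulmxA.
  have -> : v *m y = ((v *m y) 0 0)%:M by rewrite -mx11_scalar.
  by rewrite mul_mx_scalar !mxE eqxx andbT mulr1n; case: (i == i0); rewrite ?mulr1 ?mulr0.
have vE (y : 'cV[int]_d) : (v *m y) 0 0 = (p%:Z - 1) * y i0 0 - \sum_(i | i != i0) (u i)%:Z * y i 0.
  rewrite mxE (bigD1 i0) //= mxE eqxx -sumrN; congr (_ + _).
  by apply: eq_bigr => i /negbTE ii0; rewrite mxE ii0 mulNr.
have fE x : f x = (x i0 0 + \sum_(i | i != i0) (u i)%:Z * x i 0)%:~R * c.
  rewrite [in LHS](int_sum_delta x) raddf_sum (bigD1 i0) //= raddfMz.
  rewrite rmorphD rmorph_sum mulrDl mulrzl mulr_suml; congr (_ + _).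
  by apply: eq_bigr => i _; rewrite raddfMz -uE rmorphM /= -mulrzr mulrAC.
exists B => [|x].
  rewrite -det_tr; apply/det0P => -[y y_neq0 yB].
  have {}yB : B *m y^T = 0 by rewrite -[B]trmxK -trmx_mul yB trmx0.
  case/negP: y_neq0; apply/eqP/trmx_inj; rewrite trmx0; set y' := y^T in yB *.
  have y0 i : i != i0 -> y' i 0 = 0.
    by move=> /negbTE ii0; have /colP/(_ i) := yB; rewrite BE ii0 addr0 [RHS]mxE.
  apply/colP => i; rewrite [RHS]mxE; have [->|/y0 //] := eqVneq i i0.
  have /colP/(_ i0) := yB; rewrite BE eqxx vE [RHS]mxE big1 => [|k /y0 ->]; last by rewrite mulr0.
  move/eqP; rewrite subr0 mulrBl mul1r addrC subrK mulf_eq0.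
  by rewrite eqz_nat gtn_eqF ?prime_gt0 //= => /eqP.
split=> [/eqP|[y ->]].
  rewrite fE mulf_eq0 (negbTE ci0) orbF -(dvdz_pcharf (pchar_Fp p_pr)).
  case/dvdzP => q qE; exists (\col_i (if i == i0 then q else x i 0)).
  apply/colP => i; rewrite BE vE !mxE eqxx; case: eqP => [->|_]; last by rewrite addr0.
  rewrite (eq_bigr (fun i => (u i)%:Z * x i 0)) => [|k /negbTE ki]; last by rewrite mxE ki.
  by rewrite -[LHS](addrK (\sum_(i | i != i0) (u i)%:Z * x i 0)) qE; ring.
rewrite fE (eq_bigr (fun i => (u i)%:Z * y i 0)) => [|k /negbTE ki]; last first.
  by rewrite BE ki addr0.
rewrite BE eqxx vE.
apply/eqP; rewrite mulf_eq0 -(dvdz_pcharf (pchar_Fp p_pr)); apply/orP; left.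
by apply/dvdzP; exists (y i0 0); ring.
Qed.

(** * Two-sided matrix actions on column vectors *)

Section Tensor.
Variables (r n : nat).

Definition mat_of (S : Type) (x : 'cV[S]_(r * n)) : 'M[S]_(r, n) := vec_mx x^T.

(* The operator [X |-> P X Q] on [r x n] matrices, seen as column vectors. *)
Definition tens (P : 'M[int]_r) (Q : 'M[int]_n) : 'M[int]_(r * n) :=
  (lin_mulmxr Q *m lin_mulmx P)^T.

Lemma mat_of_tens P Q (x : 'cV[int]_(r * n)) :
  mat_of (tens P Q *m x) = P *m mat_of x *m Q.
Proof.
rewrite /mat_of /tens trmx_mul trmxK mulmxA -[x^T]vec_mxK.
by rewrite !mul_vec_lin /= !mxvecK mulmxA.
Qed.

Lemma mat_of_inj (S : Type) : injective (@mat_of S).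
Proof.
by move=> x y /(can_inj vec_mxK) /(can_inj (@trmxK _ _ _)).
Qed.

Lemma eq_mx_action (k : nat) (A B : 'M[int]_(k, r * n)) :
  (forall x : 'cV[int]_(r * n), A *m x = B *m x) -> A = B.
Proof.
move=> eqAB; apply/matrixP => i j.
have /colP/(_ i) := eqAB (delta_mx j 0).
by rewrite -!colE !mxE.
Qed.

Lemma tensM P Q P' Q' : tens P Q *m tens P' Q' = tens (P *m P') (Q' *m Q).
Proof.
apply: eq_mx_action => x; apply: mat_of_inj.
by rewrite -mulmxA !mat_of_tens !mulmxA.
Qed.

Lemma tens1 : tens 1%:M 1%:M = 1%:M.
Proof.
by apply: eq_mx_action => x; apply: mat_of_inj; rewrite mat_of_tens mul1mx mulmx1 mul1mx.
Qed.

Lemma tensX Q k : tens 1%:M Q ^+ k = tens 1%:M (Q ^+ k).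
Proof.
elim: k => [|k IHk]; first by rewrite !expr0 tens1.
by rewrite exprS IHk -mulmxE tensM mulmx1 exprSr.
Qed.

End Tensor.

(** * Left multiplication by zeta and j, and the lattices cut out modulo p *)

Section Lattice.
Variables (m r : nat).
Hypothesis m_ge3 : (3 <= m)%N.
Let n := totient m.
Let m_gt0 : (0 < m)%N. Proof. exact: leq_trans m_ge3. Qed.
Let n_gt0 : (0 < n)%N. Proof. by rewrite totient_gt0. Qed.

(** Rows [k] and [r + k] of the matrix of a vector hold the quaternion a + b j. Combined with
    [conj_mx], this block matrix sends (a, b) to (- conj(b), conj(a)), which is left multiplication
    by j. *)
Definition symp : 'M[int]_(r + r) := block_mx 0 (- 1%:M) 1%:M 0.

Definition rot_mx : 'M[int]_((r + r) * totient m) := tens 1%:M (zeta_mx m).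
Definition quat_mx : 'M[int]_((r + r) * totient m) := tens symp (conj_mx m).

Lemma symp_sq : symp *m symp = - 1%:M.
Proof.
rewrite /symp mulmx_block !(mul0mx, mulmx0, mul1mx, mulmx1, add0r, addr0).
by rewrite [in RHS](scalar_mx_block _ _ 1) opp_block_mx !oppr0.
Qed.

Lemma rot_mx_order : rot_mx ^+ m = 1%:M.
Proof. by rewrite /rot_mx tensX zeta_mx_order // tens1. Qed.

Lemma quat_mx_order : quat_mx ^+ 4 = 1%:M.
Proof.
have -> : quat_mx ^+ 4 = (quat_mx *m quat_mx) *m (quat_mx *m quat_mx).
  by rewrite !mulmxE -!expr2 -exprM.
by rewrite !tensM conj_mx_invol // symp_sq mulmx1 mulmxN mulNmx opprK mulmx1 tens1.
Qed.

Lemma quat_rot_mx : quat_mx *m rot_mx = rot_mx ^+ m.-1 *m quat_mx.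
Proof.
by rewrite /rot_mx /quat_mx tensX !tensM mulmx1 mul1mx zeta_conj_mx.
Qed.

Lemma rot_mx_fpf (x : 'cV[int]_((r + r) * n)) i k : (i < k < m)%N ->
  rot_mx ^+ i *m x = rot_mx ^+ k *m x -> x = 0.
Proof.
move=> ikm; rewrite !tensX => /(congr1 (@mat_of _ _ _)).
rewrite !mat_of_tens !mul1mx => eqX; apply: mat_of_inj.
rewrite {2}/mat_of trmx0 linear0; apply/row_matrixP => a; rewrite row0.
by apply: (zeta_mx_fpf m_gt0 ikm); rewrite -!row_mul eqX.
Qed.

(** Commutation would give rot^(m-1) = rot after cancelling the quaternion matrix, against
    [rot_mx_fpf], since 1 < m - 1 < m. *)
Lemma quat_rot_neq : (0 < r)%N -> quat_mx *m rot_mx != rot_mx *m quat_mx.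
Proof.
move=> r_gt0; apply/eqP; rewrite quat_rot_mx => /(congr1 (mulmx^~ (quat_mx ^+ 3))).
have q4 : quat_mx *m quat_mx ^+ 3 = 1%:M by rewrite mulmxE -exprS quat_mx_order.
rewrite /= -!mulmxA q4 !mulmx1 => eq_rot.
have d_gt0 : (0 < (r + r) * n)%N by rewrite muln_gt0 n_gt0 addn_gt0 r_gt0.
have lt_m : (1 < m.-1 < m)%N by move: m_ge3; lia.
have := @rot_mx_fpf (delta_mx (Ordinal d_gt0) 0) _ _ lt_m.
rewrite expr1 eq_rot => /(_ erefl) /matrixP /(_ (Ordinal d_gt0) 0) /eqP.
by rewrite !mxE !eqxx oner_eq0.
Qed.

Section Mod.
Variables (p : nat) (w : 'F_p).
Hypotheses (p_pr : prime p) (rw : cyc_root m w).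
Let e := powers n w.

Definition lat_form (l : 'rV['F_p]_(r + r)) : 'rV['F_p]_((r + r) * totient m) :=
  mxvec (l^T *m (powers (totient m) w)^T).

(** The functional evaluates each row at [w] and pairs the result with [l]. Imposing it on j x as
    well as on x makes the solution set stable under j. *)
Definition in_lat (l : 'rV['F_p]_(r + r)) (x : 'cV[int]_((r + r) * totient m)) :=
  (lat_form l *m intmx x == 0) && (lat_form l *m intmx (quat_mx *m x) == 0).

Lemma lat_formE l (x : 'cV[int]_((r + r) * n)) :
  lat_form l *m intmx x = l *m (intmx (mat_of x) *m e).
Proof.
rewrite mulmxA -[e]trmxK -mxvec_dotmul; congr (_ *m _).
by rewrite map_vec_mx vec_mxK map_trmx trmxK.
Qed.

Lemma lat_form_rot l (x : 'cV[int]_((r + r) * n)) :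
  lat_form l *m intmx (rot_mx *m x) = w *: (lat_form l *m intmx x).
Proof.
rewrite !lat_formE mat_of_tens mul1mx map_mxM -mulmxA zeta_mx_powers //.
by rewrite -!scalemxAr.
Qed.

Lemma lat_form_rotX l (x : 'cV[int]_((r + r) * n)) k :
  lat_form l *m intmx (rot_mx ^+ k *m x) = w ^+ k *: (lat_form l *m intmx x).
Proof.
elim: k => [|k IHk]; first by rewrite !expr0 mul1mx scale1r.
by rewrite !exprS -mulmxE -mulmxA lat_form_rot IHk scalerA.
Qed.

(** The functional is multiplied by [w] under zeta; for the second condition, j zeta = zeta^(m-1) j
    turns the factor into w^(m-1). *)
Lemma in_lat_rot l x : in_lat l x -> in_lat l (rot_mx *m x).
Proof.
case/andP => /eqP l1 /eqP l2; rewrite /in_lat lat_form_rot l1 scaler0 eqxx /=.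
by rewrite mulmxA quat_rot_mx -mulmxA lat_form_rotX l2 scaler0.
Qed.

Lemma quat_sq (x : 'cV[int]_((r + r) * n)) : quat_mx *m (quat_mx *m x) = - x.
Proof.
rewrite mulmxA tensM symp_sq conj_mx_invol //; apply: mat_of_inj.
by rewrite mat_of_tens mulmx1 mulNmx mul1mx /mat_of !linearN.
Qed.

Lemma in_lat_quat l x : in_lat l x -> in_lat l (quat_mx *m x).
Proof.
case/andP => l1 l2; rewrite /in_lat l2 /= quat_sq.
by rewrite map_mxN mulmxN oppr_eq0.
Qed.

(** Two successive kernels: the second functional is restricted to the sublattice [B1] of the
    first. *)
Lemma in_lat_basis l : exists2 B : 'M[int]_((r + r) * n), \det B != 0 &
  forall x, in_lat l x <-> exists y, x = B *m y.
Proof.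
pose f1 (x : 'cV[int]_((r + r) * n)) : 'F_p := (lat_form l *m intmx x) 0 0.
have f1B : zmod_morphism f1.
  by move=> x y; rewrite /f1 map_mxB mulmxBr !mxE.
pose F1 : {additive _ -> _} := HB.pack f1 (GRing.isZmodMorphism.Build _ _ f1 f1B).
have [B1 B1_neq0 B1P] := kernel_basis F1 p_pr.
pose f2 (x : 'cV[int]_((r + r) * n)) : 'F_p := (lat_form l *m intmx (quat_mx *m (B1 *m x))) 0 0.
have f2B : zmod_morphism f2.
  by move=> x y; rewrite /f2 !(mulmxBr, map_mxB) !mxE.
pose F2 : {additive _ -> _} := HB.pack f2 (GRing.isZmodMorphism.Build _ _ f2 f2B).
have [B2 B2_neq0 B2P] := kernel_basis F2 p_pr.
exists (B1 *m B2) => [|x]; first by rewrite det_mulmx mulf_neq0.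
have eq0 (A : 'M['F_p]_1) : (A == 0) = (A 0 0 == 0).
  by apply/eqP/eqP => [->|A0]; [rewrite mxE | apply/matrixP => i j; rewrite !ord1 A0 mxE].
rewrite /in_lat !eq0; split.
  case/andP=> /eqP/B1P [y ->] /eqP/B2P [y' ->].
  by exists y'; rewrite mulmxA.
case=> y ->; apply/andP; split; apply/eqP; rewrite -mulmxA.
  by apply/B1P; exists (B2 *m y).
by apply/B2P; exists y.
Qed.


(** The two conditions on [l] are orthogonality to the evaluations [u] of x and [u'] of j x. For
    short nonzero x these are linearly independent, so they cut out a subspace of codimension 2. *)
Lemma card_in_lat (C T : nat) (x : 'cV[int]_((r + r) * n)) :
  (forall (T : nat) (a b : 'rV[int]_n), mx_bound T%:Z a -> mx_bound T%:Z b ->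
    (`|\det (nrd_mx a b)| <= C * T ^ (2 * n))%N) ->
  (C * T ^ (2 * n) < p)%N -> mx_bound T%:Z x -> x != 0 ->
  (#|[set l | in_lat l x]| <= p ^ (r + r - 2))%N.
Proof.
move=> bC lt_p bx x_neq0.
pose X := mat_of x; pose u := intmx X *m e; pose u' := intmx (symp *m X *m conj_mx m) *m e.
have bX : mx_bound T%:Z X by move=> i j; rewrite !mxE; apply: bx.
have /existsP [i ri] : [exists i : 'I_r, (row (lshift r i) X, row (rshift r i) X) != (0, 0)].
  apply: contraR x_neq0 => /existsPn X0; apply/eqP/mat_of_inj.
  rewrite [RHS]/mat_of trmx0 linear0; apply/row_matrixP => a; rewrite row0.
  by case: (split_ordP a) => k ->; have := X0 k; rewrite negbK => /eqP [].
set a := row _ X in ri; set b := row _ X in ri.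
have ub (c : 'rV[int]_n) k : c = row k X -> mx_bound T%:Z c.
  by move=> -> i' j'; rewrite mxE; apply: bX.
(* Vanishing would make [p] divide a nonzero determinant of absolute value less than [p]. *)
have val_neq0 : nrd_val w a b != 0.
  apply/negP => /eqP /(nrd_singular m_gt0 p_pr rw) /dvdn_leq.
  rewrite absz_gt0 nrd_mx_unit // => /(_ isT).
  rewrite leqNgt (leq_ltn_trans (bC _ _ _ (ub a _ erefl) (ub b _ erefl)) lt_p) //.
have sympX : symp *m X = col_mx (- dsubmx X) (usubmx X).
  by rewrite -[X in symp *m X]vsubmxK mul_block_col !mul0mx mulNmx !mul1mx add0r addr0.
have rowE k (Y : 'M[int]_(r + r, n)) : (intmx Y *m e) k 0 = (intmx (row k Y) *m e) 0 0.
  by rewrite map_row -row_mul [RHS]mxE.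
have u'l : u' (lshift r i) 0 = - (intmx (b *m conj_mx m) *m e) 0 0.
  rewrite rowE row_mul sympX rowKu raddfN /= row_dsubmx mulNmx map_mxN mulNmx.
  by rewrite [LHS]mxE.
have u'r : u' (rshift r i) 0 = (intmx (a *m conj_mx m) *m e) 0 0.
  by rewrite rowE row_mul sympX rowKd row_usubmx.
pose U := row_mx u u'.
(* Rows [i] and [r + i] of (u, u') are (A, - B') and (B, A'); their minor A A' + B B' is the nonzero
   value of the reduced norm. *)
have U_free : row_free U^T.
  apply: inj_row_free => v vU; set al := v 0 (lshift 1 0); set be := v 0 (rshift 1 0).
  have vUk k : al * u k 0 + be * u' k 0 = 0.
    have /matrixP/(_ 0 k) := vU; rewrite [RHS]mxE mxE big_split_ord /= !big_ord1.
    by rewrite ![U^T _ _]mxE /U row_mxEl row_mxEr.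
  have := vUk (lshift r i); have := vUk (rshift r i).
  rewrite u'l u'r /u !rowE -/a -/b.
  have := val_neq0; rewrite /nrd_val -/e.
  move: ((intmx a *m e) 0 0) ((intmx b *m e) 0 0) => A B.
  move: ((intmx (a *m _) *m e) 0 0) ((intmx (b *m _) *m e) 0 0) => A' B' val e2 e1.
  have /eqP al0 : al * (A * A' + B * B') = 0.
    rewrite (_ : _ * _ = (al * A + be * - B') * A' + (al * B + be * A') * B'); last by ring.
    by rewrite e1 e2 !mul0r addr0.
  have /eqP be0 : be * (A * A' + B * B') = 0.
    rewrite (_ : _ * _ = (al * B + be * A') * A - (al * A + be * - B') * B); last by ring.
    by rewrite e1 e2 !mul0r subr0.
  move: al0 be0; rewrite !mulf_eq0 (negbTE val) !orbF => /eqP al0 /eqP be0.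
  apply/rowP => k; rewrite [RHS]mxE.
  by case: (split_ordP k) => k' ->; rewrite ord1.
have -> : [set l | in_lat l x] = rowg (kermx U).
  apply/setP => l; rewrite inE mem_rowg; apply/idP/sub_kermxP.
    rewrite /in_lat !lat_formE mat_of_tens => /andP[/eqP lu /eqP lu'].
    by rewrite mul_mx_row lu lu' row_mx0.
  rewrite mul_mx_row -[0](@row_mx0 _ 1 1) => /eq_row_mx [lu lu'].
  by rewrite /in_lat !lat_formE mat_of_tens lu lu' eqxx.
rewrite card_rowg card_Fp // leq_exp2l ?prime_gt1 // mxrank_ker -[\rank U]mxrank_tr.
by move/eqP: U_free => ->.
Qed.

(* The vectors in [S] come in orbits of size [m] under [rot_mx]; were each
   nonzero functional to vanish on one of them, averaging would give too many
   incidences. *)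
Lemma lattice_avoiding (C T : nat) (S : seq 'cV[int]_((r + r) * n)) :
  (0 < r)%N ->
  (forall (T : nat) (a b : 'rV[int]_n), mx_bound T%:Z a -> mx_bound T%:Z b ->
    (`|\det (nrd_mx a b)| <= C * T ^ (2 * n))%N) ->
  (C * T ^ (2 * n) < p)%N -> uniq S ->
  (forall x, x \in S -> [/\ mx_bound T%:Z x, x != 0 & rot_mx *m x \in S]) ->
  (4 * size S <= m * p ^ 2)%N ->
  exists l, forall x, x \in S -> ~~ in_lat l x.
Proof.
move=> r_gt0 bC lt_p uS SP sz_S; apply: contrapT => no_l.
(* A functional vanishing at one point of [S] vanishes on its whole orbit, which has [m] distinct
   points in [S]. *)
have incid l : (m <= count (in_lat l) S)%N.
  have /existsNP [x] : ~ (forall x, x \in S -> ~~ in_lat l x).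
    by move=> lS; apply: no_l; exists l.
  move=> /not_implyP [xS /negP]; rewrite negbK => lx.
  pose orb := [seq rot_mx ^+ i *m x | i <- iota 0 m].
  have orbS i : rot_mx ^+ i *m x \in S /\ in_lat l (rot_mx ^+ i *m x).
    elim: i => [|i [IH1 IH2]]; first by rewrite expr0 mul1mx.
    rewrite exprS -mulmxE -mulmxA; split; last exact: in_lat_rot.
    by have [] := SP _ IH1.
  have [_ x_neq0 _] := SP _ xS.
  have orb_uniq : uniq orb.
    rewrite map_inj_in_uniq ?iota_uniq // => i j; rewrite !mem_iota !add0n /= => im jm.
    move=> eq_ij; case: (ltngtP i j) => // ij; case/eqP: x_neq0.
      by apply: (rot_mx_fpf _ eq_ij); rewrite ij.
    by apply: (rot_mx_fpf _ (esym eq_ij)); rewrite ij.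
  rewrite -size_filter -[X in (X <= _)%N](size_iota 0) -(size_map (fun i => rot_mx ^+ i *m x)).
  apply: uniq_leq_size => // y /mapP [i _ ->].
  by have [? ?] := orbS i; rewrite mem_filter; apply/andP.
(* Double counting of the pairs (l, x): at least m p^(2r) and at most |S| p^(2r-2), which
   contradicts 4 |S| <= m p^2. *)
have : (\sum_(l : 'rV['F_p]_(r + r)) m <= \sum_(l : 'rV['F_p]_(r + r)) count (in_lat l) S)%N.
  by apply: leq_sum => l _; apply: incid.
rewrite sum_nat_const card_mx card_Fp // mul1n.
under [leqRHS]eq_bigr do rewrite -sum1_count big_mkcond /=.
rewrite exchange_big /=; apply/negP; rewrite -ltnNge.
apply: (@leq_ltn_trans (\sum_(x <- S) p ^ (r + r - 2))).
  rewrite big_seq [leqRHS]big_seq; apply: leq_sum => x xS.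
  have [bx x_neq0 _] := SP _ xS; rewrite -big_mkcond sum1dep_card.
  exact: (card_in_lat bC lt_p).
rewrite big_const_seq count_predT iter_addn_0.
have -> : (p ^ (r + r) = p ^ (r + r - 2) * p ^ 2)%N.
  by rewrite -expnD subnK //; lia.
have P_gt0 : (0 < p ^ (r + r - 2))%N by rewrite expn_gt0 prime_gt0.
have p2_gt0 : (0 < p ^ 2)%N by rewrite expn_gt0 prime_gt0.
have mp_gt0 : (0 < m * p ^ 2)%N by rewrite muln_gt0 m_gt0.
rewrite -mulnA ltn_pmul2l // [(p ^ 2 * m)%N]mulnC; lia.
Qed.

End Mod.
End Lattice.

(** * Euclidean norms and invariant ellipsoids *)

Section Enorm.
Variables (R : realType) (d : nat).
Implicit Types x y : 'cV[R]_d.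

Lemma enorm_ge0 x : 0 <= enorm x.
Proof. exact: sqrtr_ge0. Qed.

Lemma enorm_sq x : enorm x ^+ 2 = \sum_i x i 0 ^+ 2.
Proof. by rewrite sqr_sqrtr // sumr_ge0 // => i _; rewrite sqr_ge0. Qed.

Lemma enorm0 : enorm (0 : 'cV[R]_d) = 0.
Proof.
by rewrite /enorm big1 ?sqrtr0 // => i _; rewrite mxE expr0n.
Qed.

Lemma enormN x : enorm (- x) = enorm x.
Proof. by congr Num.sqrt; apply: eq_bigr => i _; rewrite mxE sqrrN. Qed.

Lemma enormZ (a : R) x : enorm (a *: x) = `|a| * enorm x.
Proof.
rewrite /enorm -sqrtr_sqr -sqrtrM ?sqr_ge0 //; congr Num.sqrt.
by rewrite mulr_sumr; apply: eq_bigr => i _; rewrite mxE exprMn.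
Qed.

Lemma coord_le_enorm x i : `|x i 0| <= enorm x.
Proof.
rewrite -sqrtr_sqr ler_wsqrtr // (bigD1 i) //= lerDl.
by apply: sumr_ge0 => j _; rewrite sqr_ge0.
Qed.

(** With D the inner product, the sum of the squares of |y|^2 x_i - D y_i is |y|^2 (|x|^2 |y|^2 -
    D^2), hence the latter is nonnegative. *)
Lemma cauchy_schwarz x y :
  \sum_i x i 0 * y i 0 <= enorm x * enorm y.
Proof.
move DE: (\sum_i _) => D; have [Q0|Q_neq0] := eqVneq (enorm y) 0.
  rewrite Q0 mulr0 -DE big1 // => i _.
  have := coord_le_enorm y i; rewrite Q0 normr_le0 => /eqP ->.
  by rewrite mulr0.
have Q_gt0 : 0 < enorm y by rewrite lt_neqAle eq_sym Q_neq0 enorm_ge0.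
have : 0 <= \sum_i (enorm y ^+ 2 * x i 0 - D * y i 0) ^+ 2.
  by apply: sumr_ge0 => i _; rewrite sqr_ge0.
have -> : \sum_i (enorm y ^+ 2 * x i 0 - D * y i 0) ^+ 2 =
    enorm y ^+ 2 * ((enorm x * enorm y) ^+ 2 - D ^+ 2).
  transitivity (enorm y ^+ 4 * \sum_i x i 0 ^+ 2 - 2 * enorm y ^+ 2 * D * (\sum_i x i 0 * y i 0)
                + D ^+ 2 * \sum_i y i 0 ^+ 2).
    rewrite !mulr_sumr -sumrN -!big_split /=; apply: eq_bigr => i _; ring.
  by rewrite -!enorm_sq DE; ring.
rewrite pmulr_rge0 ?exprn_gt0 // subr_ge0 => le_sq.
apply: le_trans (ler_norm _) _.
by rewrite -(@ler_pXn2r _ 2) ?nnegrE ?mulr_ge0 ?enorm_ge0 // real_normK ?num_real.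
Qed.

Lemma enorm_triangle x y : enorm (x + y) <= enorm x + enorm y.
Proof.
rewrite -(@ler_pXn2r _ 2) ?nnegrE ?addr_ge0 ?enorm_ge0 //.
rewrite sqrrD !enorm_sq.
have -> : \sum_i (x + y) i 0 ^+ 2 =
    \sum_i x i 0 ^+ 2 + (\sum_i x i 0 * y i 0) *+ 2 + \sum_i y i 0 ^+ 2.
  rewrite -sumrMnl -!big_split /=; apply: eq_bigr => i _.
  by rewrite mxE sqrrD.
by rewrite lerD2r lerD2l lerMn2r cauchy_schwarz.
Qed.

Lemma enorm_le_sum x : enorm x <= \sum_i `|x i 0|.
Proof.
have S_ge0 : 0 <= \sum_i `|x i 0| by apply: sumr_ge0.
rewrite -(@ler_pXn2r _ 2) ?nnegrE ?enorm_ge0 // enorm_sq expr2 mulr_sumr.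
apply: ler_sum => i _; rewrite -real_normK ?num_real // expr2 ler_wpM2r //.
by rewrite (bigD1 i) //= lerDl sumr_ge0.
Qed.

End Enorm.

Definition mx_sum (R : realType) (r c : nat) (G : 'M[R]_(r, c)) : R :=
  \sum_i \sum_j `|G i j|.

Lemma mx_sum_ge0 (R : realType) (r c : nat) (G : 'M[R]_(r, c)) : 0 <= mx_sum G.
Proof. by apply: sumr_ge0 => i _; apply: sumr_ge0. Qed.

Lemma enorm_mulmx_le (R : realType) (r c : nat) (G : 'M[R]_(r, c)) (x : 'cV[R]_c) (K : R) :
  (forall j, `|x j 0| <= K) -> enorm (G *m x) <= mx_sum G * K.
Proof.
move=> bx; apply: le_trans (enorm_le_sum _) _; rewrite mulr_suml.
apply: ler_sum => i _; rewrite mxE (le_trans (ler_norm_sum _ _ _)) // mulr_suml.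
by apply: ler_sum => j _; rewrite normrM ler_wpM2l.
Qed.

(** Induction on the size, splitting off the first row and column and factoring the Schur complement
    [S2]. *)
Lemma cholesky (R : realType) (n : nat) (S : 'M[R]_n) :
  S^T = S -> (forall x : 'cV[R]_n, x != 0 -> 0 < (x^T *m S *m x) 0 0) ->
  exists A : 'M[R]_n, A^T *m A = S.
Proof.
elim: n S => [|n IHn] S symS posS.
  by exists 0; apply/matrixP => -[].
move: S symS posS; rewrite -[n.+1]/(1 + n)%N => S symS posS.
pose a := S 0 0; pose b := ursubmx S; pose S' := drsubmx S.
have S_block : S = block_mx a%:M b b^T S'.
  rewrite -{1}[S]submxK; congr block_mx.
    by rewrite [LHS]mx11_scalar; congr _%:M; rewrite !mxE; congr (S _ _); apply: val_inj.
  by rewrite /b trmx_ursub symS.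
have a_gt0 : 0 < a.
  have := posS (delta_mx 0 0); rewrite trmx_delta -rowE -colE !mxE; apply.
  by apply/eqP => /matrixP /(_ 0 0) /eqP; rewrite !mxE oner_eq0.
pose S2 := S' - a^-1 *: (b^T *m b).
have [A' A'E] : exists A' : 'M[R]_n, A'^T *m A' = S2.
  apply: IHn.
    rewrite linearB linearZ /= trmx_mul trmxK; congr (_ - _).
    by rewrite /S' trmx_drsub symS.
  move=> x x_neq0.
  (* This lift of [x] kills the first block, so the form of [S] at [y] is that of [S2] at [x]. *)
  pose y : 'cV[R]_(1 + n) := col_mx (- a^-1 *: (b *m x)) x.
  have y_neq0 : y != 0.
    apply: contraNneq x_neq0 => y0; have := congr1 dsubmx y0.
    by rewrite col_mxKd linear0 => ->.
  have := posS y y_neq0; rewrite S_block /y tr_col_mx mul_row_block mul_row_col.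
  have -> : (- a^-1 *: (b *m x))^T *m a%:M + x^T *m b^T = 0.
    rewrite mul_mx_scalar linearZ /= scalerA mulrN divff ?gt_eqF //.
    by rewrite scaleN1r trmx_mul addNr.
  rewrite mul0mx add0r; set W := (_ + _ : 'rV_n).
  have -> // : W = x^T *m S2.
  rewrite /W linearZ /= trmx_mul -scalemxAl -mulmxA mulmxBr -scalemxAr scaleNr.
  by rewrite addrC.
have sa : Num.sqrt a != 0 by rewrite gt_eqF // sqrtr_gt0.
have sa2 : Num.sqrt a * Num.sqrt a = a by rewrite -expr2 sqr_sqrtr // ltW.
exists (block_mx (Num.sqrt a)%:M ((Num.sqrt a)^-1 *: b) 0 A').
rewrite tr_block_mx mulmx_block S_block trmx0 !mul0mx !addr0 mulmx0 addr0 A'E.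
rewrite tr_scalar_mx -scalar_mxM sa2 mul_scalar_mx mul_mx_scalar.
have -> : ((Num.sqrt a)^-1 *: b)^T = (Num.sqrt a)^-1 *: b^T by rewrite linearZ.
rewrite !scalerA !(mulVf sa, divff sa) !scale1r -scalemxAl -scalemxAr scalerA -invfM sa2.
by rewrite addrC subrK.
Qed.

(** The Euclidean form is summed over the powers of [z] and factored as A^T A; its term of index 0
    gives the comparison with [enorm x]. *)
Lemma invariant_ellipsoid (R : realType) (d m : nat) (z : 'M[int]_d) :
  (0 < m)%N -> z ^+ m = 1%:M ->
  exists A : 'M[R]_d,
    [/\ A \in unitmx,
        forall x : 'cV[int]_d, enorm (A *m intmx (z *m x)) = enorm (A *m intmx x)
      & forall x : 'cV[R]_d, enorm x <= enorm (A *m x)].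
Proof.
move=> m_gt0 zm; pose P (i : nat) : 'M[R]_d := intmx (z ^+ i).
pose S := \sum_(i < m) (P i)^T *m P i.
have dotE (k : nat) (y : 'M[R]_(k, d)) (x : 'cV[R]_d) : (y *m x)^T *m (y *m x) = x^T *m (y^T *m y) *m x.
  by rewrite trmx_mul !mulmxA.
have normE (k : nat) (x : 'cV[R]_k) : enorm x ^+ 2 = (x^T *m x) 0 0.
  by rewrite enorm_sq mxE; apply: eq_bigr => i _; rewrite mxE expr2.
have SE (x : 'cV[R]_d) : (x^T *m S *m x) 0 0 = \sum_(i < m) enorm (P i *m x) ^+ 2.
  rewrite mulmx_sumr mulmx_suml summxE; apply: eq_bigr => i _.
  by rewrite normE dotE.
have SE_ge (x : 'cV[R]_d) : enorm x ^+ 2 <= (x^T *m S *m x) 0 0.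
  rewrite SE (bigD1 (Ordinal m_gt0)) //= {1}/P expr0 (map_mx1 intr) mul1mx lerDl.
  by apply: sumr_ge0 => i _; rewrite sqr_ge0.
have enorm_gt0 (x : 'cV[R]_d) : x != 0 -> 0 < enorm x.
  move=> x_neq0; rewrite lt_neqAle enorm_ge0 andbT eq_sym.
  apply: contraNneq x_neq0 => x0; apply/eqP/colP => i; rewrite mxE.
  by apply/eqP; rewrite -normr_le0 -x0 coord_le_enorm.
have [A AE] : exists A : 'M[R]_d, A^T *m A = S.
  apply: cholesky => [|x /enorm_gt0 x_gt0].
    rewrite /S linear_sum /=; apply: eq_bigr => i _.
    by rewrite trmx_mul trmxK.
  by apply: lt_le_trans (SE_ge x); rewrite exprn_gt0.
have AnE (x : 'cV[R]_d) : enorm (A *m x) ^+ 2 = (x^T *m S *m x) 0 0.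
  by rewrite normE dotE AE.
have sq_inj (u v : R) : 0 <= u -> 0 <= v -> u ^+ 2 = v ^+ 2 -> u = v.
  by move=> u0 v0 /eqP; rewrite eqrXn2 // => /eqP.
have A_ge (x : 'cV[R]_d) : enorm x <= enorm (A *m x).
  by rewrite -(@ler_pXn2r _ 2) ?nnegrE ?enorm_ge0 // AnE.
exists A; split => //.
  rewrite -unitmx_tr -row_free_unit; apply: inj_row_free => v vA.
  have {}vA : A *m v^T = 0 by rewrite -[A]trmxK -trmx_mul vA trmx0.
  apply: trmx_inj; rewrite trmx0; apply/eqP/negPn/negP => /enorm_gt0.
  by rewrite ltNge (le_trans (A_ge _)) // vA enorm0.
move=> x; apply: sq_inj; rewrite ?enorm_ge0 // !AnE !SE.
have PE i : P i *m intmx (z *m x) = P i.+1 *m intmx x.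
  by rewrite /P -!(map_mxM intr) mulmxA exprSr mulmxE.
(* Applying [z] shifts the indices by one, and the new last term equals the old first one because
   z^m = 1. *)
under eq_bigr do rewrite PE.
case: m m_gt0 zm {S SE SE_ge AE AnE} => // k _ zk.
rewrite big_ord_recr big_ord_recl /= addrC; congr (_ + _).
by rewrite /P zk expr0.
Qed.

(** * Counting integer points *)

Lemma size_int_box (d : nat) (lo : 'I_d -> int) (k : 'I_d -> nat)
    (s : seq 'cV[int]_d) :
  uniq s -> (forall x, x \in s -> forall i, lo i <= x i 0 < lo i + (k i)%:Z) ->
  (size s <= \prod_i k i)%N.
Proof.
move=> us sP; pose K := (\max_i k i)%N.
pose F i : pred 'I_K.+1 := fun j => (j < k i)%N.
pose h (x : 'cV[int]_d) : {ffun 'I_d -> 'I_K.+1} := [ffun i => inord `|(x i 0 - lo i)%R|%N].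
have hE x i : x \in s -> ((h x i : nat) < k i)%N /\ (h x i : nat)%:Z = x i 0 - lo i.
  move=> /sP /(_ i) xi; have kK : (k i <= K)%N by apply: leq_bigmax.
  have a_lt : (`|(x i 0 - lo i)%R| < k i)%N by lia.
  rewrite ffunE inordK; last by rewrite ltnS (leq_trans (ltnW a_lt)).
  by split => //; rewrite gez0_abs // subr_ge0; case/andP: xi.
have cardF i : #|F i| = k i.
  have kK : (k i <= K.+1)%N by apply: leqW; apply: leq_bigmax.
  rewrite -sum1_card -(big_ord_widen K.+1 (fun=> 1%N)) //.
  by rewrite sum_nat_const card_ord muln1.
have -> : (\prod_i k i = #|family F|)%N.
  rewrite card_family foldrE big_map big_enum /=.
  by apply: eq_bigr => i _; rewrite cardF.
have -> : size s = size [seq h x | x <- s] by rewrite size_map.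
rewrite cardE; apply: uniq_leq_size.
  rewrite map_inj_in_uniq // => x y xs ys eq_h; apply/colP => i.
  have [_ hx] := hE _ i xs; have [_] := hE _ i ys.
  by rewrite -eq_h hx => /addIr.
move=> f /mapP [x xs ->]; rewrite mem_enum; apply/familyP => i.
by have [] := hE _ i xs.
Qed.

Lemma size_real_box (R : realType) (d : nat) (al be : 'I_d -> R)
    (s : seq 'cV[int]_d) :
  (forall i, al i <= be i) -> uniq s ->
  (forall x, x \in s -> forall i, al i < (x i 0)%:~R < be i) ->
  (size s)%:R <= \prod_i (be i - al i + 1).
Proof.
(* A point of [s] guarantees that each integer length is nonnegative, so that the absolute value in
   [k] changes nothing. *)
move=> le_ab us sP; have [s0|[x0 x0s]] : s = [::] \/ exists x, x \in s.
  by case: s {us sP} => [|x s]; [left | right; exists x; rewrite mem_head].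
  rewrite s0 /=; apply: prodr_ge0 => i _.
  by rewrite addr_ge0 // subr_ge0.
pose lo i := Num.floor (al i) + 1.
pose k i := `|(Num.ceil (be i) - lo i)%R|%N.
have xlo x i : x \in s -> lo i <= x i 0 < Num.ceil (be i).
  move=> /sP /(_ i) /andP[ax xb]; apply/andP; split.
    by rewrite /lo lezD1 floor_lt_int.
  rewrite ltNge -(ler_int R) -ltNge; apply: lt_le_trans xb _; exact: ceil_ge.
have kE i : (k i)%:Z = Num.ceil (be i) - lo i.
  have /andP[l1 l2] := xlo _ i x0s.
  by rewrite /k gez0_abs // subr_ge0 (le_trans l1) // ltW.
have le_s : (size s <= \prod_i k i)%N.
  by apply: (@size_int_box d lo) => // x xs i; rewrite kE addrCA subrr addr0 xlo.
apply: (@le_trans _ _ (\prod_i k i)%N%:R); first by rewrite ler_nat.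
rewrite natr_prod; apply: ler_prod => i _; rewrite ler0n /=.
have -> : (k i)%:R = (Num.ceil (be i) - lo i)%:~R :> R by rewrite -kE.
have /andP[c1 _] := ceil_itv (be i); have := floorD1_gt (al i).
move: c1; rewrite /lo !rmorphD !rmorphN /= !rmorphD /=; lra.
Qed.

Lemma int_box_points (d K : nat) : exists s : seq 'cV[int]_d,
  [/\ uniq s, forall x, (x \in s) = [forall i, `|x i 0| <= K%:Z]
    & size s = (K.*2.+1 ^ d)%N].
Proof.
pose g (f : {ffun 'I_d -> 'I_K.*2.+1}) : 'cV[int]_d := \col_i ((f i : nat)%:Z - K%:Z).
have g_inj : injective g.
  move=> f f' /colP eq_f; apply/ffunP => i; apply: val_inj.
  by have := eq_f i; rewrite !mxE => /addIr [].
exists [seq g f | f <- enum {: {ffun 'I_d -> 'I_K.*2.+1}}]; split.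
- by rewrite map_inj_uniq // enum_uniq.
- move=> x; apply/mapP/forallP => [[f _ ->] i|bx].
    rewrite mxE; have := ltn_ord (f i); move: (nat_of_ord (f i)) => j; lia.
  exists [ffun i => inord `|(x i 0 + K%:Z)%R|%N]; rewrite ?mem_enum //.
  by apply/colP => i; rewrite mxE ffunE inordK; have := bx i; move: (x i 0) => t; lia.
by rewrite size_map -cardE card_ffun !card_ord.
Qed.

Local Open Scope classical_set_scope.
Local Open Scope ring_scope.

Section Counting.
Variables (R : realType) (d : nat) (A : 'M[R]_d).
Hypothesis A_unit : A \in unitmx.

(** [fset_set] is empty on an infinite set, so membership needs [zpts_finite]. *)
Definition zpts (T : R) : seq 'cV[int]_d :=
  finmap.enum_fset (fset_set [set x : 'cV[int]_d | enorm (A *m intmx x) < T]).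

Lemma coord_le_mx (x : 'cV[R]_d) i :
  `|x i 0| <= mx_sum (invmx A) * enorm (A *m x).
Proof.
rewrite -[x in leLHS](mulKmx A_unit).
apply: le_trans (coord_le_enorm _ _) _.
by apply: enorm_mulmx_le => j; apply: coord_le_enorm.
Qed.

Lemma zpts_finite (T : R) :
  finite_set [set x : 'cV[int]_d | enorm (A *m intmx x) < T].
Proof.
pose K := Num.bound (mx_sum (invmx A) * T).
have [s [_ sE _]] := int_box_points d K.
apply: (@sub_finite_set _ _ [set` s]); last exact: finite_seq.
move=> x /= xT; rewrite sE; apply/forallP => i.
rewrite -(ler_int R) intr_norm; have := coord_le_mx (intmx x) i; rewrite mxE => /le_trans; apply.
apply: le_trans (_ : mx_sum (invmx A) * T <= _).
  by rewrite ler_wpM2l ?mx_sum_ge0 // ltW.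
apply/ltW/archi_boundP; rewrite mulr_ge0 ?mx_sum_ge0 //.
by rewrite (le_trans _ (ltW xT)) // enorm_ge0.
Qed.

Lemma mem_zpts T x : (x \in zpts T) = (enorm (A *m intmx x) < T).
Proof.
rewrite /zpts (in_fset_set (zpts_finite T)).
by apply/idP/idP => [/set_mem //|xT]; apply/mem_set.
Qed.

Lemma zpts_uniq T : uniq (zpts T).
Proof. exact: finmap.fset_uniq. Qed.

Let f (T : R) : R := (size (zpts T))%:R / T ^+ d.

(** The ellipsoid contains a cube of half-side proportional to [T]. *)
Lemma zpts_lower : exists2 k : R, 0 < k & forall T, 0 < T -> k * T ^+ d <= (size (zpts T))%:R.
Proof.
pose c := mx_sum A + 1.
have c_gt0 : 0 < c by rewrite ltr_wpDl ?mx_sum_ge0.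
exists (c^-1 ^+ d) => [|T T_gt0]; first by rewrite exprn_gt0 ?invr_gt0.
pose K := Num.truncn (T / c).
have T_c : 0 <= T / c by rewrite divr_ge0 // ltW.
have [s [us sE sz_s]] := int_box_points d K.
have le_s : (size s <= size (zpts T))%N.
  apply: uniq_leq_size => // x; rewrite sE mem_zpts => /forallP bx.
  have : enorm (A *m intmx x) <= mx_sum A * K%:R.
    by apply: enorm_mulmx_le => j; rewrite mxE -intr_norm -[K%:R]/(K%:Z%:~R) ler_int.
  move=> /le_lt_trans; apply; apply: (@le_lt_trans _ _ (mx_sum A * (T / c))).
    by rewrite ler_wpM2l ?mx_sum_ge0 // truncn_le.
  rewrite mulrA ltr_pdivrMr // mulrC ltr_pM2l // /c; lra.
rewrite -exprMn mulrC; apply: (@le_trans _ _ (size s)%:R); last by rewrite ler_nat.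
rewrite sz_s natrX lerXn2r ?nnegrE //.
have /truncn_itv /andP[_ /ltW] := T_c; rewrite -/K => /le_trans; apply.
by rewrite ler_nat ltnS -addnn leq_addr.
Qed.

(** The ellipsoid lies in a cube of half-side [c * T]; the condition [1 <= T] absorbs the additive 1
    of [size_real_box]. *)
Lemma zpts_upper : exists2 k : R, 0 < k & forall T, 1 <= T -> (size (zpts T))%:R <= k * T ^+ d.
Proof.
pose c := mx_sum (invmx A) + 1.
have c_gt0 : 0 < c by rewrite ltr_wpDl ?mx_sum_ge0.
exists ((2 * c + 1) ^+ d) => [|T T_ge1]; first by rewrite exprn_gt0 // ltr_wpDl // mulr_ge0 // ltW.
have T_gt0 : 0 < T by apply: lt_le_trans T_ge1.
have := @size_real_box R d (fun _ => - (c * T)) (fun _ => c * T) (zpts T).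
rewrite prodr_const card_ord => H; apply: le_trans (H _ (zpts_uniq T) _) _.
- by move=> _; rewrite -subr_ge0 opprK addr_ge0 // mulr_ge0 // ltW.
- move=> x; rewrite mem_zpts => xT i; rewrite -ltr_norml.
  have := coord_le_mx (intmx x) i; rewrite mxE => /le_lt_trans; apply.
  apply: (@le_lt_trans _ _ (mx_sum (invmx A) * T)).
    by rewrite ler_wpM2l ?mx_sum_ge0 // ltW.
  by rewrite ltr_pM2r // /c ltrDl.
have cT_ge0 : 0 <= c * T by rewrite mulr_ge0 // ltW.
rewrite opprK -exprMn lerXn2r ?nnegrE //.
- by rewrite !addr_ge0.
- by rewrite mulr_ge0 ?addr_ge0 ?mulr_ge0 // ltW.
have -> : (2 * c + 1) * T = c * T + c * T + T by ring.
by rewrite lerD2l.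
Qed.

(* [c] is the upper limit of the number of points divided by [T ^+ d]. *)
Lemma zpts_limsup : exists2 c : R, 0 < c &
  (exists T0, forall T, T0 <= T -> (size (zpts T))%:R <= 2 * c * T ^+ d) /\
  (forall T0, exists2 T, T0 <= T & c / 2 * T ^+ d <= (size (zpts T))%:R).
Proof.
have [k1 k1_gt0 lo] := zpts_lower; have [k2 k2_gt0 up] := zpts_upper.
have Td_gt0 T : 1 <= T -> 0 < T ^+ d by move=> T1; rewrite exprn_gt0 // (lt_le_trans _ T1).
have fP T : 1 <= T -> k1 <= f T <= k2.
  move=> T1; rewrite /f ler_pdivlMr ?ler_pdivrMr ?Td_gt0 // up // lo //.
  exact: lt_le_trans T1.
pose F T0 := [set f T | T in [set T | Num.max 1 T0 <= T]].
have F_ub T0 : has_ubound (F T0).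
  exists k2 => _ [T /= leT <-].
  have T1 : 1 <= T by rewrite (le_trans _ leT) // le_max lexx.
  by have /andP[] := fP T T1.
have F_mem T0 : F T0 (f (Num.max 1 T0)) by exists (Num.max 1 T0) => /=.
have F_sup T0 : has_sup (F T0) by split=> //; exists (f (Num.max 1 T0)).
pose G := range (fun T0 => sup (F T0)).
have G_lb : lbound G k1.
  move=> _ [T0 _ <-]; apply: le_trans (ub_le_sup (F_ub T0) (F_mem T0)).
  have T1 : 1 <= Num.max 1 T0 by rewrite le_max lexx.
  by have /andP[] := fP _ T1.
have G_inf : has_inf G by split; [exists (sup (F 0)); exists 0 | exists k1].
have c_ge : k1 <= inf G by apply: lb_le_inf => //; case: G_inf.
have c_gt0 : 0 < inf G by apply: lt_le_trans c_ge.
exists (inf G) => //; split.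
  (* Approximating the infimum within its own value produces the factor 2. *)
  have [_ [T0 _ <-] lt_sup] := @inf_adherent _ G (inf G) c_gt0 G_inf.
  exists (Num.max 1 T0) => T leT; have T1 : 1 <= T by rewrite (le_trans _ leT) // le_max lexx.
  rewrite -ler_pdivrMr ?Td_gt0 //; apply: (@le_trans _ _ (sup (F T0))).
    by apply: ub_le_sup => //; exists T.
  by rewrite ltW // (lt_le_trans lt_sup) //; lra.
move=> T0; have le_sup : inf G <= sup (F T0) by apply: ge_inf; [case: G_inf | exists T0].
have eps_gt0 : 0 < sup (F T0) - inf G / 2 by lra.
have [_ [T /= leT <-]] := sup_adherent eps_gt0 (F_sup T0).
rewrite subKr => ltf; exists T.
  by rewrite (le_trans _ leT) // le_max lexx orbT.
have T1 : 1 <= T by rewrite (le_trans _ leT) // le_max lexx.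
by rewrite -ler_pdivlMr ?Td_gt0 // ltW.
Qed.

(** Each fibre of [phi] is translated into [P] by subtracting a fixed representative, which enlarges
    the radius by a bounded amount [c]. *)
Lemma zpts_coset (K : finType) (phi : 'cV[int]_d -> K) (P : pred 'cV[int]_d) :
  (forall x y, phi x = phi y -> P (x - y)) ->
  exists c : R, forall T, (size (zpts T) <= #|K| * count P (zpts (T + c)))%N.
Proof.
move=> phiP.
have /choice [v vP] : forall k, exists v, (exists x, phi x = k) -> phi v = k.
  move=> k; have [[x xk]|nx] := pselect (exists x, phi x = k); first by exists x.
  by exists 0.
pose c : R := \sum_k enorm (A *m intmx (v k)).
exists c => T.
have -> : size (zpts T) = (\sum_(k : K) count (fun x => phi x == k) (zpts T))%N.
  under eq_bigr do rewrite -sum1_count big_mkcond /=.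
  rewrite exchange_big /= -sum1_size; apply: eq_bigr => x _.
  by rewrite -big_mkcond /= (big_pred1 (phi x)) // => k; rewrite eq_sym.
rewrite -sum_nat_const; apply: leq_sum => k _.
rewrite -!size_filter -(size_map (fun x => x - v k)).
apply: uniq_leq_size.
  rewrite map_inj_uniq ?filter_uniq ?zpts_uniq //; exact: addIr.
move=> _ /mapP [x + ->]; rewrite !mem_filter !mem_zpts => /andP[/eqP xk xT].
have vk : phi (v k) = k by apply: vP; exists x.
rewrite phiP ?vk //= map_mxB mulmxBr (le_lt_trans (enorm_triangle _ _)) // enormN.
by rewrite ltr_leD // /c (bigD1 k) //= lerDl sumr_ge0 // => i _; apply: enorm_ge0.
Qed.

End Counting.

(** * Outer measure and point counts *)

Lemma continuous_sum_ord (R : realType) (U : topologicalType) (d : nat) (F : 'I_d -> U -> R) :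
  (forall i, continuous (F i)) -> continuous (fun x => \sum_i F i x).
Proof.
move=> F_cont x; apply: cvg_big => [|i _]; last exact: F_cont.
exact: add_continuous.
Qed.

Lemma enorm_ball_compact (R : realType) (d : nat) (r : R) :
  compact [set v : 'rV[R]_d | enorm v^T <= r].
Proof.
have box_cpt : compact [set v : 'rV[R]_d | forall i, `[- r, r]%classic (v ord0 i)].
  by apply: (@rV_compact _ _ (fun=> `[- r, r]%classic)) => _; apply: segment_compact.
apply: (subclosed_compact _ box_cpt) => [|v /= vr i]; last first.
  rewrite in_itv /= -ler_norml; apply: le_trans vr.
  by have := coord_le_enorm v^T i; rewrite mxE.
have cont : continuous (fun v : 'rV[R]_d => enorm v^T).
  rewrite (_ : (fun v : 'rV[R]_d => enorm v^T) =
      Num.sqrt \o (fun v : 'rV[R]_d => \sum_i v 0 i ^+ 2)).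
    move=> v; apply: continuous_comp; last exact: sqrt_continuous.
    apply: continuous_sum_ord => i x.
    apply: (@continuous_comp _ _ _ (fun v : 'rV[R]_d => v 0 i) (fun t : R => t ^+ 2)).
      exact: coord_continuous.
    exact: exprn_continuous.
  by apply/funext => v /=; congr Num.sqrt; apply: eq_bigr => i _; rewrite mxE.
by move/continuous_closedP: cont => /(_ [set t | t <= r]); apply; exact: closed_le.
Qed.

Lemma preim_box_open (R : realType) (d : nat) (G : 'M[R]_d) (al be : 'I_d -> R) :
  open [set v : 'rV[R]_d | forall i, al i < (G *m v^T) i 0 < be i].
Proof.
rewrite openE => v vP; rewrite /interior /=.
pose h i (w : 'rV[R]_d) : R := (G *m w^T) i 0.
have h_cont i : continuous (h i).
  rewrite (_ : h i = fun w => \sum_j G i j * w 0 j).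
    apply: continuous_sum_ord => j x.
    apply: (@continuousM _ _ (cst (G i j)) (fun w : 'rV[R]_d => w 0 j)).
      exact: cst_continuous.
    exact: coord_continuous.
  by apply/funext => w; rewrite /h mxE; apply: eq_bigr => j _; rewrite mxE.
have : \forall w \near v, forall i, al i < h i w < be i.
  apply: (@filter_forall _ _ (fun i w => al i < h i w < be i) (nbhs v)) => i.
  have /andP[gt_al lt_be] := vP i.
  near=> w; apply/andP; split; near: w.
    exact: (cvgr_gt (h i v) (h_cont i v)).
  exact: (cvgr_lt (h i v) (h_cont i v)).
by apply: filterS.
Unshelve. all: by end_near.
Qed.

(** Continuity at 0 of a polynomial in [t]. Of the 3 t, two come from widening a side at both ends
    and one pays for the additive 1 of [size_real_box]. *)
Lemma box_enlarge (R : realType) (d : nat) (c : 'I_d -> R) (e : R) : 0 < e ->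
  exists2 t, 0 < t & \prod_i (c i + 3 * t) <= \prod_i c i + e.
Proof.
move=> e_gt0; pose p : {poly R} := \prod_i ((c i)%:P + 3%:P * 'X).
have pE t : p.[t] = \prod_i (c i + 3 * t).
  by rewrite horner_prod; apply: eq_bigr => i _; rewrite !hornerE.
have := @continuous_horner R p 0.
move=> /cvgrPdist_lt /(_ e e_gt0) /nbhs_ballP [t t_gt0 ball_t].
exists (t / 2); first by rewrite divr_gt0.
have : ball 0 t (t / 2).
  rewrite /ball /= sub0r normrN ger0_norm ?divr_ge0 // ?ltW //.
  by rewrite ltr_pdivrMr // ltr_pMr // ltr1n.
move=> /ball_t /=; rewrite !pE.
have -> : \prod_i (c i + 3 * 0) = \prod_i c i.
  by apply: eq_bigr => i _; rewrite mulr0 addr0.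
rewrite ltr_norml => /andP[le1 _]; lra.
Qed.

(** Given a cover by boxes, the boxes are widened to open ones, and finitely many of them cover the
    compact image of the ball of radius [rho]. Rescaled, they contain all the counted points, and
    each holds about its volume times T'^d of them. *)
Lemma vol_lower (R : realType) (d : nat) (G : 'M[R]_d) (K rho : R) :
  G \in unitmx -> 0 <= K -> 0 < rho < 1 ->
  (forall T0, exists2 T, T0 <= T & K * T ^+ d <= (size (zpts (invmx G) T))%:R) ->
  ((K * rho ^+ d)%:E <= lebesgue_vol (linear_image G (eball 1)))%E.
Proof.
move=> G_unit K_ge0 /andP[rho_gt0 rho_lt1] many.
apply: le_ereal_inf_tmp => _ [a [b [ab cov ->]]].
pose vol k := \prod_i (b k i 0 - a k i 0).
have vol_ge0 k : 0 <= vol k by apply: prodr_ge0 => i _; rewrite subr_ge0.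
apply/lee_addgt0Pr => e e_gt0.
have /choice [t tP] : forall k, exists t, 0 < t /\
    \prod_i (b k i 0 - a k i 0 + 3 * t) <= vol k + e / (2 ^ (k + 1))%:R.
  move=> k; have [|t t_gt0 tP] := @box_enlarge R d (fun i => b k i 0 - a k i 0) (e / (2 ^ (k + 1))%:R).
    by rewrite divr_gt0 // ltr0n expn_gt0.
  by exists t.
pose O k := [set v : 'rV[R]_d | forall i, a k i 0 - t k < (G *m v^T) i 0 < b k i 0 + t k].
have := @enorm_ball_compact R d rho; rewrite compact_cover.
move=> /(_ nat [set: nat] O) [k _|v /= v_rho|D _ D_cov].
- exact: preim_box_open.
- have /cov [k _ vk] : linear_image G (eball 1) (G *m v^T).
    by exists v^T => //; rewrite /eball /= (le_lt_trans v_rho).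
  exists k => // i; have /andP[l1 l2] := vk i; have [t_gt0 _] := tP k.
  by apply/andP; split; lra.
have [n nP] : exists n, forall k, k \in finmap.enum_fset D -> (k < n)%N.
  exists (\max_(k <- finmap.enum_fset D) k).+1 => k kD; rewrite ltnS.
  exact: (@leq_bigmax_seq _ _ xpredT id).
(* From [T0] on, T' * t k is at least 1 for every box of the finite subcover. *)
pose T0 := 1 + \sum_(k < n) (t k)^-1.
have [T leT sz_T] := many T0; pose T' := T / rho.
have T0_ge1 : 1 <= T0.
  by rewrite lerDl sumr_ge0 // => k _; rewrite invr_ge0 ltW //; have [] := tP k.
have T_gt0 : 0 < T by rewrite (lt_le_trans _ leT) // (lt_le_trans _ T0_ge1).
have T'_gt0 : 0 < T' by rewrite divr_gt0.
have leT' : T <= T' by rewrite ler_pdivlMr // ler_piMr // ltW.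
have T't k : (k < n)%N -> 1 <= T' * t k.
  move=> kn; have [tk_gt0 _] := tP k; rewrite -ler_pdivrMr // div1r.
  apply: le_trans leT'; apply: le_trans leT; rewrite /T0 (bigD1 (Ordinal kn)) //=.
  rewrite addrCA lerDl addr_ge0 // sumr_ge0 // => j _.
  by rewrite invr_ge0 ltW //; have [] := tP j.
pose s := zpts (invmx G) T.
pose inO k (x : 'cV[int]_d) := `[< forall i, T' * (a k i 0 - t k) < (x i 0)%:~R < T' * (b k i 0 + t k) >].
have sO x : x \in s -> exists k : 'I_n, inO k x.
  rewrite mem_zpts ?unitmx_inv // => xT.
  pose v := (T'^-1 *: (invmx G *m intmx x))^T.
  have /D_cov [k kD kO] : enorm v^T <= rho.
    rewrite trmxK enormZ ger0_norm ?invr_ge0 ?(ltW T'_gt0) //.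
    by rewrite mulrC ler_pdivrMr // mulrC divfK ?gt_eqF // ltW.
  exists (Ordinal (nP k kD)); apply/asboolP => i /=.
  have := kO i; rewrite trmxK -scalemxAr mulKVmx // !mxE mulrC.
  by rewrite ltr_pdivlMr // ltr_pdivrMr // ![_ * T']mulrC.
have count_le (k : 'I_n) : (count (inO k) s)%:R <= T' ^+ d * (vol k + e / (2 ^ (k + 1))%:R).
  have [tk_gt0 tkP] := tP k.
  have := @size_real_box R d (fun i => T' * (a k i 0 - t k)) (fun i => T' * (b k i 0 + t k))
     [seq x <- s | inO k x].
  rewrite size_filter => H; apply: le_trans (H _ _ _) _.
  - by move=> i; rewrite ler_pM2l //; move: (ab k i); lra.
  - by rewrite filter_uniq // zpts_uniq.
  - by move=> x; rewrite mem_filter => /andP[/asboolP].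
  apply: le_trans (ler_wpM2l _ tkP); last by rewrite exprn_ge0 // ltW.
  rewrite -[X in T' ^+ X]card_ord -prodr_const -big_split /=.
  apply: ler_prod => i _; have := T't k (ltn_ord k); move: (ab k i) => abk T'tk.
  have : 0 <= T' * (b k i 0 - a k i 0) by rewrite mulr_ge0 ?subr_ge0 // ltW.
  by rewrite !mulrDr !mulrN => ?; apply/andP; split; lra.
have sz_le : (size s)%:R <= \sum_(k < n) (count (inO k) s)%:R :> R.
  rewrite -natr_sum ler_nat.
  under eq_bigr do rewrite -sum1_count big_mkcond /=.
  rewrite exchange_big /= -sum1_size big_seq [leqRHS]big_seq.
  apply: leq_sum => x /sO [k kx].
  by rewrite (bigD1 k) //= kx leq_addr.
have main : K * rho ^+ d <= \sum_(k < n) (vol k + e / (2 ^ (k + 1))%:R).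
  have Td : T ^+ d = T' ^+ d * rho ^+ d by rewrite -exprMn divfK // gt_eqF.
  have T'd_gt0 : 0 < T' ^+ d by rewrite exprn_gt0.
  rewrite -(ler_pM2l T'd_gt0) mulr_sumr mulrCA -Td.
  by apply: le_trans sz_T _; apply: le_trans sz_le _; apply: ler_sum.
have geo : \sum_(k < n) e / (2 ^ (k + 1))%:R <= e.
  suff -> : \sum_(k < n) e / (2 ^ (k + 1))%:R = e - e / (2 ^ n)%:R.
    by rewrite gerBl divr_ge0 // ltW.
  elim: (n) => [|j IHj]; first by rewrite big_ord0 expn0 divr1 subrr.
  rewrite big_ord_recr /= IHj addn1 expnS natrM; field.
  by rewrite pnatr_eq0 expn_eq0.
apply: (@le_trans _ _ ((\sum_(k < n) vol k)%:E + e%:E)%E).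
  by rewrite -EFinD lee_fin (le_trans main) // big_split /= lerD2l.
rewrite leeD2r // -sumEFin.
rewrite -(big_mkord xpredT (fun k => (vol k)%:E)).
by apply: (@nneseries_lim_ge _ (fun k => (vol k)%:E)) => k _ _; rewrite lee_fin.
Qed.

(** * The packing *)

Section DicyclicGroup.
Variables (d m : nat) (z q : 'M[int]_d).
Hypotheses (zm : z ^+ m = 1) (q4 : q ^+ 4 = 1) (qz : q * z = z ^+ m.-1 * q).

(** The exponents are unbounded, which keeps the closure proofs free of reductions; finiteness comes
    afterwards from the orders [m] and 4. *)
Definition dicyclic (g : 'M[int]_d) : Prop := exists i k, g = z ^+ i * q ^+ k.

Lemma dicyclicM g h : dicyclic g -> dicyclic h -> dicyclic (g * h).
Proof.
move=> [i [k ->]] [i' [k' ->]].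
have qzX j : q * z ^+ j = z ^+ (m.-1 * j) * q.
  elim: j => [|j IHj]; first by rewrite muln0 !expr0 mul1r mulr1.
  by rewrite exprSr mulrA IHj -mulrA qz mulrA -exprD mulnS addnC.
have [j qkz] : exists j, q ^+ k * z ^+ i' = z ^+ j * q ^+ k.
  elim: k => [|k [j IHk]]; first by exists i'; rewrite expr0 mul1r mulr1.
  by exists (m.-1 * j)%N; rewrite exprS -mulrA IHk mulrA qzX -mulrA.
exists (i + j)%N, (k + k')%N.
by rewrite -mulrA [q ^+ k * _]mulrA qkz -mulrA -exprD mulrA -exprD.
Qed.

Lemma dicyclic1 : dicyclic 1.
Proof. by exists 0%N, 0%N; rewrite !expr0 mulr1. Qed.

Lemma dicyclicV g : (0 < m)%N -> dicyclic g ->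
  exists h, [/\ dicyclic h, g * h = 1 & h * g = 1].
Proof.
move=> m_gt0 [i [k ->]]; exists (q ^+ (3 * k) * z ^+ (m.-1 * i)); split.
- apply: dicyclicM; [exists 0%N, (3 * k)%N | exists (m.-1 * i)%N, 0%N].
    by rewrite expr0 mul1r.
  by rewrite expr0 mulr1.
- rewrite -mulrA [q ^+ k * _]mulrA -exprD (_ : k + 3 * k = 4 * k)%N; last by lia.
  rewrite [q ^+ _]exprM q4 expr1n mul1r -exprD -mulSn prednK //.
  by rewrite exprM zm expr1n.
- rewrite -mulrA [z ^+ _ * _]mulrA -exprD -mulSnr prednK // [z ^+ _]exprM zm expr1n mul1r.
  rewrite -exprD (_ : 3 * k + k = 4 * k)%N; last by lia.
  by rewrite exprM q4 expr1n.
Qed.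

Lemma dicyclic_finite : (0 < m)%N -> finite_set dicyclic.
Proof.
move=> m_gt0.
apply: (@sub_finite_set _ _ [set` [seq z ^+ i * q ^+ k | i <- iota 0 m, k <- iota 0 4]]).
  move=> _ [i [k ->]]; apply/allpairsPdep; exists (i %% m)%N, (k %% 4)%N.
  rewrite !mem_iota !ltn_mod /= m_gt0; split => //.
  by rewrite (expr_mod i zm) (expr_mod k q4).
exact: finite_seq.
Qed.

End DicyclicGroup.

Section Conjugate.
Variables (R : realType) (d m : nat) (z q B : 'M[int]_d).
Hypotheses (m_gt0 : (0 < m)%N) (zm : z ^+ m = 1) (q4 : q ^+ 4 = 1).
Hypotheses (qz : q * z = z ^+ m.-1 * q) (qz_neq : q * z != z * q).
Hypotheses (detB : \det B != 0).
Hypothesis stableB : forall y : 'cV[int]_d,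
  (exists y', z *m (B *m y) = B *m y') /\ (exists y', q *m (B *m y) = B *m y').

Let BR : 'M[R]_d := intmx B.
Let phi (g : 'M[int]_d) : 'M[R]_d := invmx BR *m intmx g *m BR.

Lemma intmx_unit : BR \in unitmx.
Proof. by rewrite unitmxE det_map_mx unitfE intr_eq0. Qed.

Let phiM g h : phi (g * h) = phi g *m phi h.
Proof.
by rewrite /phi -mulmxE (map_mxM intr) !mulmxA mulmxK // intmx_unit.
Qed.

Let phi1 : phi 1 = 1%:M.
Proof. by rewrite /phi (map_mx1 intr) mulmx1 mulVmx // intmx_unit. Qed.

Let phi_inj : injective phi.
Proof.
move=> g h /(congr1 (fun X => BR *m X *m invmx BR)).
rewrite /phi /= !mulmxA !mulmxV ?intmx_unit // !mul1mx -!mulmxA !mulmxV ?intmx_unit // !mulmx1.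
by move=> /matrixP gh; apply/matrixP => i j; have := gh i j; rewrite !mxE => /intr_inj.
Qed.

(** Conjugation by [B] carries the sublattice B Z^d to Z^d, so that the final lattice is the
    standard one. *)
Definition dicyclic_conj : set 'M[R]_d := [set phi g | g in dicyclic z q].

Let phiV g : dicyclic z q g -> exists2 h, dicyclic z q h &
  phi g \in unitmx /\ invmx (phi g) = phi h.
Proof.
move=> /(dicyclicV zm q4 qz m_gt0) [h [hG gh hg]]; exists h => //.
have gh1 : phi g *m phi h = 1%:M by rewrite -phiM gh phi1.
have [g_unit _] := mulmx1_unit gh1; split => //.
by rewrite -[RHS]mul1mx -(mulVmx g_unit) -mulmxA gh1 mulmx1.
Qed.

Lemma dicyclic_conj_group : [/\ is_matrix_group dicyclic_conj,
  finite_set dicyclic_conj & noncommutative dicyclic_conj].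
Proof.
split; first split.
- by move=> _ [g /phiV [h _ [? _]] <-].
- by exists 1 => //; exact: dicyclic1.
- move=> _ _ [g gG <-] [h hG <-]; exists (g * h); rewrite ?phiM //.
  exact: (dicyclicM qz).
- by move=> _ [g /phiV [h hG [_ gV]] <-]; rewrite gV; exists h.
- exact/finite_image/(dicyclic_finite zm q4).
exists (phi q), (phi z); split.
- by exists q => //; exists 0%N, 1%N; rewrite expr0 mul1r expr1.
- by exists z => //; exists 1%N, 0%N; rewrite expr0 mulr1 expr1.
by rewrite -!phiM (inj_eq phi_inj).
Qed.

Lemma int_vectorsP (x : 'cV[R]_d) : int_vectors x <-> exists y, x = intmx y.
Proof.
split=> [xZ|[y ->] i]; last by rewrite mxE intr_int.
exists (\col_i Num.floor (x i 0)); apply/colP => i.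
by rewrite !mxE floorK.
Qed.

Lemma dicyclic_conj_lattice h : dicyclic_conj h ->
  linear_image h int_vectors = int_vectors.
Proof.
have stable g : dicyclic z q g -> forall y : 'cV[int]_d, exists y' : 'cV[int]_d, intmx y' = phi g *m intmx y.
  move=> [i [k ->]].
  have stab (g' : 'M[int]_d) : (forall y : 'cV[int]_d, exists y', g' *m (B *m y) = B *m y') ->
      forall y : 'cV[int]_d, exists y' : 'cV[int]_d, intmx y' = phi g' *m intmx y.
    move=> g'B y; have [y' E] := g'B y; exists y'.
    by rewrite /phi -!mulmxA -!(map_mxM intr) E (map_mxM intr) mulKmx // intmx_unit.
  apply: stab => y.
  have [y1 E1] : exists y' : 'cV[int]_d, q ^+ k *m (B *m y) = B *m y'.
    elim: k => [|k [y' IHk]]; first by exists y; rewrite expr0 mul1mx.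
    by have [_ [y'' E]] := stableB y'; exists y''; rewrite exprS -mulmxE -mulmxA IHk.
  elim: i => [|i [y' IHi]]; first by exists y1; rewrite expr0 mul1r.
  have [[y'' E] _] := stableB y'; exists y''.
  by rewrite exprS -mulrA -mulmxE -mulmxA IHi.
move=> [g gG <-]; apply/seteqP; split.
  move=> _ [x /int_vectorsP [y ->] <-]; apply/int_vectorsP.
  by have [y' E] := stable g gG y; exists y'.
(* The reverse inclusion is the stability of Z^d under the inverse element. *)
move=> x /int_vectorsP [y ->].
have [g' g'G [g_unit gV]] := phiV gG; have [y' E] := stable g' g'G y.
exists (intmx y'); first by apply/int_vectorsP; exists y'.
by rewrite E -gV mulKVmx.
Qed.

End Conjugate.

(** * Normalisation and volume of the packing ellipsoid *)

Lemma nth_root_exists (R : realType) (d : nat) (x : R) : (0 < d)%N -> 0 < x ->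
  exists2 s, 0 < s & s ^+ d = x.
Proof.
move=> d_gt0 x_gt0; exists (x `^ d%:R^-1); first exact: powR_gt0.
rewrite -powR_mulrn ?powR_ge0 // -powRrM mulVf ?powRr1 ?ltW //.
by rewrite pnatr_eq0 -lt0n.
Qed.

(** Scaling by the [d]-th root of |det G| and composing with the orthogonal matrix [D], which
    corrects the sign, brings the determinant to 1 without changing the ellipsoid. *)
Lemma ellipsoid_packing (R : realType) (d : nat) (G : 'M[R]_d) : (0 < d)%N ->
  G \in unitmx -> linear_image G (eball 1) `&` int_vectors = [set 0] ->
  (lebesgue_vol (linear_image G (eball 1)) <= lattice_packing_constant R d)%E.
Proof.
move=> d_gt0 G_unit GZ; apply: ereal_sup_ubound.
have det_neq0 : \det G != 0 by rewrite -unitfE -unitmxE.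
have absG_gt0 : 0 < `|\det G| by rewrite normr_gt0.
have [r r_gt0 rE] := nth_root_exists d_gt0 absG_gt0.
pose sg : R := Num.sg (\det G).
have sg2 : sg * sg = 1 by rewrite -expr2 sqr_sg det_neq0.
pose D : 'M[R]_d := diag_mx (\row_i (if i == Ordinal d_gt0 then sg else 1)).
have detD : \det D = sg.
  rewrite det_diag (bigD1 (Ordinal d_gt0)) //= mxE eqxx big1 ?mulr1 // => i /negbTE i0.
  by rewrite mxE i0.
have DD : D *m D = 1%:M.
  apply/matrixP => i j; rewrite mul_diag_mx !mxE; case: (i == j); rewrite ?mulr0 // mulr1n.
  by case: ifP; rewrite ?mulr1.
have enormD x : enorm (D *m x) = enorm x.
  congr Num.sqrt; apply: eq_bigr => i _; rewrite mul_diag_mx !mxE exprMn.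
  by case: ifP; rewrite ?expr1n ?mul1r // expr2 sg2 mul1r.
have same : linear_image (r^-1 *: (G *m D)) (eball r) = linear_image G (eball 1).
  apply/seteqP; split=> _ [x xb <-].
    exists (r^-1 *: (D *m x)); last by rewrite -scalemxAr -scalemxAl mulmxA.
    rewrite /eball /= enormZ enormD gtr0_norm ?invr_gt0 // mulrC.
    by rewrite ltr_pdivrMr // mul1r.
  exists (r *: (D *m x)).
    by rewrite /eball /= enormZ enormD gtr0_norm // gtr_pMr.
  rewrite -scalemxAl -scalemxAr scalerA mulVf ?gt_eqF // scale1r -mulmxA.
  by rewrite [D *m (D *m x)]mulmxA DD mul1mx.
exists r, (r^-1 *: (G *m D)); split; rewrite ?same //.
rewrite detZ det_mulmx detD exprVn rE /sg [\det G * _]mulrC -normrEsg.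
by rewrite mulVf // gt_eqF.
Qed.

(* Passing to the sublattice [B Z^d], of index at most [#|K|], divides the
   density of points by at most [#|K|]. *)
Lemma sublattice_vol_lower (R : realType) (d : nat) (A : 'M[R]_d) (B : 'M[int]_d)
    (K : finType) (phi : 'cV[int]_d -> K) (c s : R) (G := s *: invmx (A *m intmx B)) :
  (0 < d)%N -> A \in unitmx -> \det B != 0 -> 0 < c -> 0 < s ->
  (forall x y, phi x = phi y -> exists v, x - y = B *m v) ->
  (forall T0, exists2 T, T0 <= T & c / 2 * T ^+ d <= (size (zpts A T))%:R) ->
  ((c / 4 * s ^+ d / #|K|%:R)%:E <= lebesgue_vol (linear_image G (eball 1)))%E.
Proof.
move=> d_gt0 A_unit detB c_gt0 s_gt0 phiP many.
have BR_unit : intmx B \in (unitmx : {pred 'M[R]_d}) by apply: intmx_unit.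
have AB_unit : A *m intmx B \in unitmx by rewrite unitmx_mul A_unit.
have s_unit : s \is a GRing.unit by rewrite unitfE gt_eqF.
have G_unit : G \in unitmx by rewrite unitmxZ ?unitmx_inv.
have GE (y : 'cV[int]_d) : enorm (invmx G *m intmx y) = enorm (A *m intmx (B *m y)) / s.
  rewrite /G invmxZ ?unitmx_inv // invmxK -scalemxAl enormZ gtr0_norm ?invr_gt0 //.
  by rewrite mulrC (map_mxM intr) mulmxA.
have K_gt0 : 0 < #|K|%:R :> R by rewrite ltr0n; apply/card_gt0P; exists (phi 0).
have half_gt0 : 0 < 2^-1 :> R by rewrite invr_gt0.
have dd_gt0 : (0 < d + d)%N by rewrite addn_gt0 d_gt0.
(* One factor rho^d is lost in [vol_lower], the other absorbs the shift of the radius; together they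
   cost 1/2, turning c / 2 into c / 4. *)
have [rho rho_gt0 rhoE] := nth_root_exists dd_gt0 half_gt0.
have rho_lt1 : rho < 1.
  by rewrite -(expr_lt1 dd_gt0 (ltW rho_gt0)) rhoE invf_lt1 // ltr1n.
have -> : c / 4 * s ^+ d / #|K|%:R = (c / 2 * s ^+ d / #|K|%:R * rho ^+ d) * rho ^+ d.
  by rewrite -[RHS]mulrA -exprD rhoE; field; rewrite gt_eqF.
apply: vol_lower => //.
- by rewrite !mulr_ge0 ?exprn_ge0 ?divr_ge0 ?invr_ge0 // ltW.
- by rewrite rho_gt0.
pose P : pred 'cV[int]_d := fun x => `[< exists v, x = B *m v >].
have phiP' x y : phi x = phi y -> P (x - y) by move=> /phiP ?; apply/asboolP.
have [c3 coset] := zpts_coset A_unit phiP'.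
pose c' := Num.max c3 0; have c'_ge0 : 0 <= c' by rewrite le_max lexx orbT.
(* The last bound ensures rho (V + c') <= V, and the middle one that the new radius reaches [U0]. *)
move=> U0; pose U1 := Num.max 1 (Num.max (s * U0) (rho * c' / (1 - rho))).
have [V leV many_V] := many U1.
have V_ge1 : 1 <= V by rewrite (le_trans _ leV) // le_max lexx.
have V_gt0 : 0 < V by apply: lt_le_trans V_ge1.
have V_ge2 : s * U0 <= V by rewrite (le_trans _ leV) // !le_max lexx orbT.
have V_ge3 : rho * (V + c') <= V.
  have : rho * c' / (1 - rho) <= V by rewrite (le_trans _ leV) // !le_max lexx !orbT.
  by rewrite ler_pdivrMr ?subr_gt0 //; lra.
exists ((V + c') / s).
  by rewrite ler_pdivlMr // mulrC; apply: le_trans V_ge2 _; rewrite lerDl.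
have sub : (count P (zpts A (V + c3)) <= size (zpts (invmx G) ((V + c') / s)))%N.
  rewrite -size_filter -[leqRHS](size_map (mulmx B)); apply: uniq_leq_size.
    by rewrite filter_uniq // zpts_uniq.
  move=> x; rewrite mem_filter mem_zpts // => /andP[/asboolP [y ->] lt_y].
  apply/map_f; rewrite mem_zpts ?unitmx_inv // GE ltr_pM2r ?invr_gt0 //.
  by apply: lt_le_trans lt_y _; rewrite lerD2l le_max lexx.
have := coset V; rewrite -(ler_nat R) natrM => cosV.
rewrite -(ler_nat R) in sub.
rewrite -(ler_pM2l K_gt0); apply: le_trans (ler_wpM2l (ltW K_gt0) sub).
apply: le_trans cosV; apply: le_trans many_V.
have -> : #|K|%:R * (c / 2 * s ^+ d / #|K|%:R * rho ^+ d * ((V + c') / s) ^+ d) =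
    c / 2 * (rho * (V + c')) ^+ d.
  rewrite !exprMn exprVn; field; rewrite expf_neq0 ?gt_eqF //.
rewrite ler_wpM2l ?divr_ge0 ?(ltW c_gt0) // lerXn2r ?nnegrE ?(ltW V_gt0) //.
by rewrite mulr_ge0 ?addr_ge0 // ltW.
Qed.

Lemma packing_ellipsoid (R : realType) (m : nat) (d := ((3 + 3) * totient m)%N) :
  (3 <= m)%N ->
  exists (G : 'M[R]_d) (H : set 'M[R]_d),
    [/\ G \in unitmx, linear_image G (eball 1) `&` int_vectors = [set 0],
        ((m%:R / 32)%:E <= lebesgue_vol (linear_image G (eball 1)))%E,
        [/\ is_matrix_group H, finite_set H & noncommutative H]
      & forall h, H h -> linear_image h int_vectors = int_vectors].
Proof.
move=> m_ge3; have m_gt0 : (0 < m)%N by apply: leq_trans m_ge3.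
set n := totient m in d *; have n_gt0 : (0 < n)%N by rewrite totient_gt0.
have d_gt0 : (0 < d)%N by rewrite muln_gt0.
pose z := rot_mx m 3; pose q := quat_mx m 3.
have zm : z ^+ m = 1 by apply: rot_mx_order.
have [A [A_unit Ainv A_ge]] := invariant_ellipsoid R m_gt0 zm.
have [c c_gt0 [[T0 upper] many]] := zpts_limsup A_unit.
have [C CP] := nrd_mx_bound m.
have mR_gt0 : 0 < m%:R :> R by rewrite ltr0n.
pose T1 := Num.max T0 1.
(* For [p] beyond [bd], the first summand makes the radius [s] at least [T1], and the second yields
   [CT_lt]. *)
pose bd : R := 8 * c * T1 ^+ d / m%:R + C%:R ^+ 3 * (2 ^+ d * (m%:R / (8 * c))).
have T1_ge1 : 1 <= T1 by rewrite le_max lexx orbT.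
have T1_gt0 : 0 < T1 by apply: lt_le_trans T1_ge1.
have [p [w [p_gt p_pr rw]]] := cyc_prime_exists (Num.bound bd) m_gt0.
have c8_gt0 : 0 < 8 * c by rewrite mulr_gt0.
have bd1_ge0 : 0 <= 8 * c * T1 ^+ d / m%:R.
  by rewrite divr_ge0 ?mulr_ge0 ?exprn_ge0 // ltW.
have bd2_ge0 : 0 <= C%:R ^+ 3 * (2 ^+ d * (m%:R / (8 * c))).
  by rewrite !mulr_ge0 ?exprn_ge0 ?invr_ge0 // ltW.
have bd_lt : bd < p%:R.
  have : bd < (Num.bound bd)%:R by apply: archi_boundP; apply: addr_ge0.
  by move/lt_le_trans; apply; rewrite ler_nat ltnW.
have p_gt0 : 0 < p%:R :> R by rewrite ltr0n prime_gt0.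
have p_ge1 : 1 <= p%:R :> R by rewrite ler1n prime_gt0.
(* With this radius, 2 c s^d = m p^2 / 4 bounds the number of points as averaging requires, while c
   s^d / (4 p^2) = m / 32 is the volume obtained. *)
have [s s_gt0 sd] : exists2 s : R, 0 < s & s ^+ d = m%:R * p%:R ^+ 2 / (8 * c).
  by apply: nth_root_exists => //; rewrite !mulr_gt0 ?invr_gt0 ?exprn_gt0.
have s_ge : T1 <= s.
  rewrite -(@ler_pXn2r _ d) ?nnegrE ?(ltW T1_gt0) ?(ltW s_gt0) // sd.
  rewrite ler_pdivlMr // mulrC.
  have bd1_le : 8 * c * T1 ^+ d / m%:R <= p%:R.
    by apply: le_trans (ltW bd_lt); rewrite /bd; move: bd2_ge0; move: (_ * (2 ^+ d * _)) => u; lra.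
  rewrite ler_pdivrMr // in bd1_le; apply: le_trans bd1_le _.
  by rewrite mulrC ler_pM2l // expr2 ler_peMr // ltW.
pose T := (Num.truncn s).+1.
have sT : s < T%:R by have /truncn_itv /andP[] := ltW s_gt0.
have T_le : T%:R <= 2 * s.
  rewrite /T -natr1; have : (Num.truncn s)%:R <= s by rewrite truncn_le // ltW.
  by have := le_trans T1_ge1 s_ge; lra.
(* Rank 3 is used here: as d = 6 phi(m), the cube of C T^(2n) is at most a constant times s^d, of
   order p^2, hence less than p^3. *)
have CT_lt : (C * T ^ (2 * n) < p)%N.
  rewrite -(ltr_nat R) -(@ltr_pXn2r _ 3) ?nnegrE ?ler0n //.
  rewrite natrM exprMn natrX -exprM.
  have -> : (2 * n * 3 = d)%N by rewrite mulnAC.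
  apply: (@le_lt_trans _ _ (C%:R ^+ 3 * (2 * s) ^+ d)).
    by rewrite ler_wpM2l ?exprn_ge0 // lerXn2r ?nnegrE ?mulr_ge0 // ltW.
  rewrite exprMn sd [p%:R ^+ 3]exprSr.
  have -> : C%:R ^+ 3 * (2 ^+ d * (m%:R * p%:R ^+ 2 / (8 * c))) =
     p%:R ^+ 2 * (C%:R ^+ 3 * (2 ^+ d * (m%:R / (8 * c)))) by ring.
  rewrite ltr_pM2l ?exprn_gt0 //; apply: le_lt_trans bd_lt.
  by rewrite /bd; move: bd1_ge0; move: (_ / _) => u; lra.
pose S := [seq x <- zpts A s | x != 0].
have zpts_z x : x \in zpts A s -> z *m x \in zpts A s by rewrite !mem_zpts // Ainv.
have SP x : x \in S -> [/\ mx_bound T%:Z x, x != 0 & z *m x \in S].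
  rewrite !mem_filter => /andP[x_neq0 xs]; split => //.
    move=> i j; rewrite ord1 -(ler_int R) intr_norm.
    have := coord_le_enorm (intmx x : 'cV[R]_d) i; rewrite [(intmx x) i 0]mxE.
    move/le_trans; apply; apply: le_trans (A_ge _) _; rewrite mem_zpts // in xs.
    by apply: ltW; apply: lt_trans xs _.
  rewrite zpts_z // andbT; apply: contraNneq x_neq0 => zx0.
  have zE : z ^+ m = z ^+ m.-1 *m z by rewrite mulmxE -exprSr prednK.
  by rewrite -[x]mul1mx -[1%:M]zm zE -mulmxA zx0 mulmx0.
have sz_S : (4 * size S <= m * p ^ 2)%N.
  rewrite -(ler_nat R) 2!natrM natrX.
  have sz_le : (size S)%:R <= (size (zpts A s))%:R :> R.
    by rewrite ler_nat size_filter count_size.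
  have s_ge0 : T0 <= s by apply: le_trans s_ge; rewrite le_max lexx.
  have := upper s s_ge0; rewrite sd.
  have -> : 2 * c * (m%:R * p%:R ^+ 2 / (8 * c)) = m%:R * p%:R ^+ 2 / 4.
    by field; rewrite gt_eqF.
  by move: sz_le; lra.
have uS : uniq S by rewrite filter_uniq // zpts_uniq.
have [l lP] := lattice_avoiding m_ge3 p_pr rw (isT : (0 < 3)%N) CP CT_lt uS SP sz_S.
have [B detB BP] := @in_lat_basis m 3 p w p_pr l.
have BR_unit : intmx B \in (unitmx : {pred 'M[R]_d}) by apply: intmx_unit.
have s_unit : s \is a GRing.unit by rewrite unitfE gt_eqF.
pose G := s *: invmx (A *m intmx B).
have AB_unit : A *m intmx B \in unitmx by rewrite unitmx_mul A_unit.
have G_unit : G \in unitmx by rewrite unitmxZ ?unitmx_inv.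
have GV : invmx G = s^-1 *: (A *m intmx B) by rewrite invmxZ ?unitmx_inv // invmxK.
have q4 : q ^+ 4 = 1 by apply: quat_mx_order.
have qz : q * z = z ^+ m.-1 * q by apply: quat_rot_mx.
have qz_neq : q * z != z * q by apply: quat_rot_neq.
have stableB (y : 'cV[int]_d) :
    (exists y', z *m (B *m y) = B *m y') /\ (exists y', q *m (B *m y) = B *m y').
  have By : in_lat w l (B *m y) by apply/BP; exists y.
  split; apply/BP; first exact: in_lat_rot.
  exact: in_lat_quat.
have lat_pt (y : 'cV[int]_d) : enorm (A *m intmx (B *m y)) < s -> y = 0.
  move=> lt_s; have : in_lat w l (B *m y) by apply/BP; exists y.
  move=> By; have By0 : B *m y = 0.
    apply/eqP; apply: contraLR By => By_neq0; apply: lP.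
    by rewrite mem_filter By_neq0 mem_zpts.
  have := congr1 (mulmx (\adj B)) By0; rewrite mulmx0 mulmxA mul_adj_mx mul_scalar_mx.
  by move/eqP; rewrite scalemx_eq0 (negbTE detB) => /eqP.
have GE (y : 'cV[int]_d) : enorm (invmx G *m intmx y) = enorm (A *m intmx (B *m y)) / s.
  rewrite GV -scalemxAl enormZ gtr0_norm ?invr_gt0 // mulrC.
  by rewrite (map_mxM intr) mulmxA.
exists G, (dicyclic_conj z q B); split.
- exact: G_unit.
- apply/seteqP; split=> x; last first.
    move=> ->; split; last by move=> i; rewrite mxE.
    by exists 0; rewrite ?mulmx0 // /eball /= enorm0.
  move=> [[v v1 <-] /int_vectorsP [y yE]].
  rewrite yE (lat_pt y) /= ?map_mx0 //.
  have := GE y; rewrite -yE mulKmx // => vE.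
  by have := v1; rewrite /eball /= vE ltr_pdivrMr // mul1r.
- pose K : finType := ('M['F_p]_1 * 'M['F_p]_1)%type.
  pose phi (x : 'cV[int]_d) : K :=
    (lat_form m w l *m intmx x, lat_form m w l *m intmx (q *m x)).
  have phiP x y : phi x = phi y -> exists v, x - y = B *m v.
    move=> [e1 e2]; apply/BP; rewrite /in_lat mulmxBr !map_mxB !mulmxBr e1 -/q.
    by rewrite e2 !subrr eqxx.
  have cardK : #|K| = (p ^ 2)%N.
    by rewrite card_prod !card_mx card_Fp // !muln1 expn1 -expnS.
  have -> : m%:R / 32 = c / 4 * s ^+ d / #|K|%:R :> R.
    by rewrite cardK natrX sd; field; rewrite !gt_eqF.
  exact: sublattice_vol_lower phiP many.
- exact: (dicyclic_conj_group R m_gt0 zm q4 qz qz_neq detB).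
- by move=> h; apply: (dicyclic_conj_lattice m_gt0 zm q4 qz detB stableB).
Qed.

(** This makes the dimensions tend to infinity: if 2^k exactly divides the factorial, then k > j,
    and the totient is at least 2^(k-1) > k - 1. *)
Lemma totient_fact_even (j : nat) : (j <= totient (2 * j.+1)`!)%N.
Proof.
have log_ge k : (k <= logn 2 (2 * k)`!)%N.
  elim: k => // k IHk; rewrite mulnS !addSn add0n !factS.
  rewrite !lognM ?muln_gt0 ?fact_gt0 //.
  have : (0 < logn 2 (2 * k).+2)%N by rewrite logn_gt0 mem_primes /= dvdn2 /= oddM.
  by lia.
have := log_ge j.+1; set m := (_)`!; set k := logn 2 m => jk.
have m_gt0 : (0 < m)%N by apply: fact_gt0.
rewrite -(partnC 2%N m_gt0) totient_coprime ?coprime_partC // p_part -/k.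
rewrite totient_pfactor //; last by apply: leq_trans jk.
rewrite mul1n; apply: leq_trans (leq_pmulr _ _); last by rewrite totient_gt0 part_gt0.
apply: ltnW; apply: leq_trans (ltn_expl k.-1 (ltnSn 1)).
by rewrite ltnS -ltnS prednK // (leq_trans _ jk).
Qed.

Theorem theorem3p3 (R : realType) :
  exists (d : nat -> nat) (C : R),
    [/\ forall i, (0 < d i)%N,
        d @ \oo --> \oo,
        0 < C
      & forall i,
          ((C * (d i)%:R * ln (ln (d i)%:R) `^ (7 / 24))%:E
             < lattice_packing_constant R (d i))%E
          /\ exists (L : set 'cV[R]_(d i)) (H : set 'M[R]_(d i))
                    (E : set 'cV[R]_(d i)),
               [/\ lattice_of_covolume 1 L,
                   [/\ is_matrix_group H, finite_set H & noncommutative H],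
                   forall h, H h -> linear_image h L = L,
                   is_open_ellipsoid E
                 & ((C * (d i)%:R * ln (ln (d i)%:R) `^ (7 / 24))%:E
                      < lebesgue_vol E)%E /\ E `&` L = [set 0]]].
Proof.
(* Starting from 4! ensures [3 <= m i]; an even argument is the form required by
   [totient_fact_even]. *)
pose m i := (2 * i.+2)`!.
pose d i := ((3 + 3) * totient (m i))%N.
have d_gt0 i : (0 < d i)%N by rewrite muln_gt0 totient_gt0 fact_gt0.
exists d, 400^-1; split=> [//|||i].
- apply/cvgnyPge => N; near=> i.
  have le_Ni : (N <= i)%N by near: i; exact: nbhs_infty_ge.
  apply: leq_trans le_Ni _; apply: leq_trans (leqnSn i) _.
  apply: leq_trans (totient_fact_even i.+1) _.
  by rewrite -/(m i) /d leq_pmull.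
- by rewrite invr_gt0 ltr0n.
have m_ge3 : (3 <= m i)%N.
  by apply: (@leq_trans 4`!) => //; apply: leq_fact; rewrite !mulnS.
have [G [H [G_unit GZ vol_ge H_group H_lat]]] := packing_ellipsoid R m_ge3.
have vol_gt : ((400^-1 * (d i)%:R * ln (ln ((d i)%:R : R)) `^ (7 / 24))%:E
    < lebesgue_vol (linear_image G (eball 1)))%E.
  by apply: lt_le_trans vol_ge; rewrite lte_fin; apply: loglog_growth; rewrite mulnS.
split; first exact: lt_le_trans vol_gt (ellipsoid_packing (d_gt0 i) G_unit GZ).
(* The lattice is Z^d itself, the change of basis being already contained in [G] and [H]. *)
exists int_vectors, H, (linear_image G (eball 1)); split => //.
- exists 1%:M; rewrite unitmx1 det1 normr1; split => //.
  by apply/seteqP; split=> [x xZ|_ [x xZ <-]]; [exists x; rewrite ?mul1mx | rewrite mul1mx].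
- by exists G.
Unshelve. all: by end_near.
Qed.
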